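(* Let $(X,d,\mu)$ be a uniformly perfect metric-measure space and fix parameters $\sigma\in(1,\infty)$ and $s\in(0,\infty)$. Then the following statements are equivalent. (a) There exists a constant $\kappa\in(0,\infty)$ satisfying $$\frac{\mu(B(x,r))}{\mu(B(y,R))}\ge\kappa\left(\frac rR\right)^s$$ whenever $x,y\in X$ satisfy $B(x,r)\subseteq B(y,R)$ and $0<r\le R<\infty$. (b) There exist $p\in(0,s)$ and $C\in(0,\infty)$ such that, with $p^*=sp/(s-p)$, for every ball $B_0:=B(x_0,R_0)$ with $x_0\in X$ and $R_0\in(0,\infty)$ one has $$\left(\frac1{\mu(B_0)}\int_{B_0}|u|^{p^*}d\mu\right)^{1/p^*}\le CR_0\left(\frac1{\mu(\sigma B_0)}\int_{\sigma B_0}g^p\,d\mu\right)^{1/p}+C\left(\frac1{\mu(\sigma B_0)}\int_{\sigma B_0}|u|^p\,d\mu\right)^{1/p}$$ whenever $u\in M^{1,p}(\sigma B_0,d,\mu)$ and $g\in D(u)$. (c) There exist $p\in(0,s)$ and $C\in(0,\infty)$ such that, with $p^*=sp/(s-p)$, for every ball $B_0:=B(x_0,R_0)$ with $x_0\in X$ and $R_0\in(0,\infty)$ one has $$\inf_{\gamma\in\mathbb R}\left(\frac1{\mu(B_0)}\int_{B_0}|u-\gamma|^{p^*}d\mu\right)^{1/p^*}\le CR_0\left(\frac1{\mu(\sigma B_0)}\int_{\sigma B_0}g^p\,d\mu\right)^{1/p}$$ whenever $u\in M^{1,p}(\sigma B_0,d,\mu)$ and $g\in D(u)$. (d) There exist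 $p\in(s,\infty)$ and $C\in(0,\infty)$ such that for each $u\in M^{1,p}(X,d,\mu)$ and $g\in D(u)$, and each ball $B_0:=B(x_0,R_0)$ with $x_0\in X$ and finite $R_0\in(0,\operatorname{diam}(X)]$, after possibly redefining $u$ on a set of $\mu$-measure zero, $$|u(x)-u(y)|\le C\,d(x,y)^{1-s/p}R_0^{s/p}\left(\frac1{\mu(\sigma B_0)}\int_{\sigma B_0}g^p\,d\mu\right)^{1/p}\quad\text{for every }x,y\in B_0.$$ (Hence, every function $u\in M^{1,p}(\sigma B_0,d,\mu)$ has a Hölder continuous representative of order $1-s/p$ on $B_0$.)
   Context: A metric-measure space $(X,d,\mu)$ is a metric space $(X,d)$ with a Borel measure $\mu$ such that $0<\mu(B(x,r))<\infty$ for all $x\in X$, $r\in(0,\infty)$, where $B(x,r)=\{y\in X: d(x,y)<r\}$. Metric spaces are always assumed to have at least two points. Balls come with a specified center and radius; for $B=B(x,r)$ and $\tau>0$, $\tau B:=B(x,\tau r)$. $(X,d)$ is uniformly perfect if there is $\lambda\in(0,1)$ such that for each $x\in X$ and $r\in(0,\infty)$, $B(x,r)\setminus B(x,\lambda r)\neq\emptyset$ whenever $X\setminus B(x,r)\neq\emptyset$. ''Finite $R_0\in(0,\operatorname{diam}(X)]$'' means $R_0\in(0,\operatorname{diam}(X)]$ if $\operatorname{diam}(X)<\infty$ and $R_0\in(0,\infty)$ if $\operatorname{diam}(X)=\infty$. For a nonempty open set $\Omega\subseteq X$ (including $\Omega=X$) and $0<p<\infty$, $M^{1,p}(\Omega,d,\mu)$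 is the set of $u\in L^p(\Omega,\mu)$ (real-valued, functions equal $\mu$-a.e. being identified) for which there are $0\le g\in L^p(\Omega,\mu)$ and a set $N\subseteq\Omega$ with $\mu(N)=0$ such that $|u(x)-u(y)|\le d(x,y)(g(x)+g(y))$ for all $x,y\in\Omega\setminus N$. $D(u)$ denotes the class of all such functions $g$. *)

(* Defs.v *)
From HB Require Import structures.
From mathcomp Require Import all_boot all_order all_algebra.
From mathcomp Require Import all_classical all_reals all_analysis.

Set Implicit Arguments.
Unset Strict Implicit.
Unset Printing Implicit Defensive.

Import Order.TTheory GRing.Theory Num.Theory.
Import numFieldNormedType.Exports.

Local Open Scope classical_set_scope.
Local Open Scope ring_scope.

HB.mixin Record isBorel (d : measure_display) T
    & Topological T & Measurable d T := {
  measurable_borelE : (@measurable d T) = <<s @open T >>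
}.

(* The base point imposed by [Measurable] costs no generality: the spaces
   considered below have at least two points. *)
#[short(type="borelMetricType")]
HB.structure Definition BorelMetric (R : numDomainType) (d : measure_display) :=
  { T of Metric R T & Measurable d T & isBorel d T }.

Section MetricMeasure.
Context {R : realType} {d : measure_display} {X : borelMetricType R d}.
Variable mu : {measure set X -> \bar R}.

Definition metric_measure_space : Prop :=
  (exists x y : X, x != y) /\
  (forall (x : X) (r : R), 0 < r -> (0 < mu (ball x r) < +oo)%E).

Definition uniformly_perfect : Prop :=
  exists lambda : R, 0 < lambda < 1 /\
    forall (x : X) (r : R), 0 < r ->
      [set: X] `\` ball x r !=set0 ->
      ball x r `\` ball x (lambda * r) !=set0.

Definition diameter : \bar R :=
  ereal_sup [set e | exists x y : X, e = (mdist x y)%:E].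

(* Functions on Omega are represented by total functions on X whose values
   outside Omega are irrelevant. *)
Definition Lp_on (Omega : set X) (p : R) (u : X -> R) : Prop :=
  measurable_fun Omega u /\
  (\int[mu]_(x in Omega) (`|u x| `^ p)%:E < +oo)%E.

Definition hajlasz_gradient (Omega : set X) (p : R) (u g : X -> R) : Prop :=
  [/\ forall x, Omega x -> 0 <= g x,
      Lp_on Omega p g &
      exists N : set X, [/\ N `<=` Omega, mu.-negligible N &
        forall x y, (Omega `\` N) x -> (Omega `\` N) y ->
          `|u x - u y| <= mdist x y * (g x + g y)]].

Definition M1p (Omega : set X) (p : R) (u : X -> R) : Prop :=
  Lp_on Omega p u /\ exists g, hajlasz_gradient Omega p u g.

Definition pmean (A : set X) (p : R) (u : X -> R) : \bar R :=
  (((mu A)^-1 * \int[mu]_(x in A) (`|u x| `^ p)%:E) `^ p^-1)%E.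

Definition sobolev_exponent (s p : R) : R := s * p / (s - p).

Definition measure_lower_bound (s kappa : R) : Prop :=
  forall (x y : X) (r r' : R),
    ball x r `<=` ball y r' -> 0 < r -> r <= r' ->
    ((kappa * (r / r') `^ s)%:E <= mu (ball x r) / mu (ball y r'))%E.

Definition sobolev_estimate (sigma s p C : R) : Prop :=
  forall (x0 : X) (R0 : R), 0 < R0 ->
  forall u g : X -> R,
    M1p (ball x0 (sigma * R0)) p u ->
    hajlasz_gradient (ball x0 (sigma * R0)) p u g ->
    (pmean (ball x0 R0) (sobolev_exponent s p) u <=
       (C * R0)%:E * pmean (ball x0 (sigma * R0)) p g +
       C%:E * pmean (ball x0 (sigma * R0)) p u)%E.

Definition sobolev_poincare_estimate (sigma s p C : R) : Prop :=
  forall (x0 : X) (R0 : R), 0 < R0 ->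
  forall u g : X -> R,
    M1p (ball x0 (sigma * R0)) p u ->
    hajlasz_gradient (ball x0 (sigma * R0)) p u g ->
    (ereal_inf [set pmean (ball x0 R0) (sobolev_exponent s p)
                      (fun x => (u x - gamma)%R) | gamma in [set: R]] <=
       (C * R0)%:E * pmean (ball x0 (sigma * R0)) p g)%E.

(* The representative v of u may depend on g and on the ball. *)
Definition holder_estimate (sigma s p C : R) : Prop :=
  forall u g : X -> R, M1p [set: X] p u -> hajlasz_gradient [set: X] p u g ->
  forall (x0 : X) (R0 : R), 0 < R0 -> (R0%:E <= diameter)%E ->
  exists v : X -> R, {ae mu, forall x, v x = u x} /\
    forall x y, ball x0 R0 x -> ball x0 R0 y ->
      (`|v x - v y|%:E <=
         (C * mdist x y `^ (1 - s / p) * R0 `^ (s / p))%:E *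
         pmean (ball x0 (sigma * R0)) p g)%E.

Definition holder_on (A : set X) (alpha : R) (v : X -> R) : Prop :=
  exists H : R, forall x y, A x -> A y ->
    `|v x - v y| <= H * mdist x y `^ alpha.

Definition holder_representatives (sigma s p : R) : Prop :=
  forall (x0 : X) (R0 : R), 0 < R0 -> (R0%:E <= diameter)%E ->
  forall u : X -> R, M1p (ball x0 (sigma * R0)) p u ->
  exists v : X -> R, {ae mu, forall x, ball x0 R0 x -> v x = u x} /\
    holder_on (ball x0 R0) (1 - s / p) v.

End MetricMeasure.

Arguments uniformly_perfect {R d} X.
Arguments diameter {R d} X.

(* Main.v *)
(* From the lower bound to the embeddings, no averages of [u] are used, since [p] may
   be less than 1. With [G] bounding the [L^p] mean of [g] over [W = sigma B0], Chebyshev's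
   inequality makes [{g > t}] so small, compared with the lower bound on the mass of
   balls, that every ball in [W] of radius about [R0 * (G / t) ^ (p / s)] meets
   [{g <= t}]. Descending through the levels [4 ^ n * t0] joins almost every [x] in [B0] to
   a point of [{g <= t0}], where [t0] is of order [G] and [u] is [2 * t0]-Lipschitz, at a
   cost [R0 * G * \sum_(i < n) 4 ^ (i * (1 - p / s))] in [u]. For [p > s] the sum converges,
   and applying this on the balls [B (x, 2 d (x, y))] gives the Hoelder estimate. For
   [p = s / 2], where [p^* = s], the sum is of order [(g x / G) ^ (1 / 2)], whose power
   [p^*] is [(g x / G) ^ p], and integrating gives the Sobolev estimates.

   Conversely, the Sobolev estimates applied to cutoffs on a shrinking sequence of
   concentric balls give a recursion of De Giorgi type on their masses, which would
   force the masses to tend to 0 if the first one were too small. The Hoelder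
   estimate is applied to a single cutoff, uniform perfectness providing a second point
   at a distance comparable to the radius. *)
Require Import Defs.
From mathcomp Require Import all_boot all_order all_algebra.
From mathcomp Require Import all_classical all_reals all_analysis.
From mathcomp Require Import measurable_realfun ring lra.

Set Implicit Arguments.
Unset Strict Implicit.
Unset Printing Implicit Defensive.

Import Order.TTheory GRing.Theory Num.Theory.
Import numFieldNormedType.Exports.
Local Open Scope classical_set_scope.
Local Open Scope ring_scope.

(** * Real powers *)

Section PowR.
Context {R : realType}.
Implicit Types x y p : R.

Lemma powR_inv x p : 0 <= x -> x^-1 `^ p = (x `^ p)^-1.
Proof. by move=> x0; rewrite -powR_inv1// -powRrM mulN1r powRN. Qed.

Lemma powR_div x y p : 0 <= x -> 0 <= y -> (x / y) `^ p = x `^ p / y `^ p.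
Proof. by move=> x0 y0; rewrite powRM ?invr_ge0// powR_inv. Qed.

Lemma powR_le1 x p : 0 <= x <= 1 -> 0 <= p -> x `^ p <= 1.
Proof.
move=> /andP[x0 x1] p0; have := @ge0_ler_powR R p p0 x 1.
by rewrite powR1 !nnegrE; apply.
Qed.

End PowR.

(** * Balls and means *)

Section MetricMeasureBasics.
Context {R : realType} {d : measure_display} {X : borelMetricType R d}.
Variable mu : {measure set X -> \bar R}.
Implicit Types (x y z : X) (A B W : set X) (u g : X -> R).

Lemma in_ballP x r y : ball x r y <-> mdist x y < r.
Proof. by rewrite ballEmdist. Qed.

Lemma sub_ball x y r r' : mdist x y + r <= r' -> ball y r `<=` ball x r'.
Proof.
move=> h z /in_ballP yz; apply/in_ballP.
have := metric_triangle x y z; lra.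
Qed.

Lemma ball_self x r : 0 < r -> ball x r x.
Proof. by move=> r0; apply/in_ballP; rewrite mdistxx. Qed.

Lemma open_metric_ball x r : open (ball x r).
Proof.
rewrite openE => y /in_ballP xy; apply/nbhs_ballP; exists (r - mdist x y) => /=.
  by rewrite subr_gt0.
by apply: sub_ball; rewrite addrC subrK.
Qed.

Lemma measurable_metric_ball x r : measurable (ball x r).
Proof.
rewrite (@measurable_borelE R d X); apply: sub_sigma_algebra.
exact: open_metric_ball.
Qed.

Lemma measurable_mdist x : measurable_fun [set: X] (mdist x : X -> R).
Proof.
apply: (measurability _ (RGenInftyO.measurableE R)) => _ [_ [r ->] <-].
rewrite setTI.
have -> : mdist x @^-1` `]-oo, r[%classic = ball x r.
  by apply/seteqP; split=> y /=; rewrite in_itv/= => /in_ballP.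
exact: measurable_metric_ball.
Qed.

Lemma integral_powR_ge0 A p u : (0 <= \int[mu]_(x in A) (`|u x| `^ p)%:E)%E.
Proof. by apply: integral_ge0 => x _; rewrite lee_fin powR_ge0. Qed.

Lemma pmean_ge0 A p u : (0 <= pmean mu A p u)%E.
Proof. exact: poweR_ge0. Qed.

(** Raising to the power [p] and clearing the finite positive mass is reversible. Mean bounds are
    handled in this root-free form, which adapts to Chebyshev's inequality and to a change of
    domain. *)
Lemma pmean_le A p u G : 0 < p -> 0 <= G -> (0 < mu A < +oo)%E ->
  (pmean mu A p u <= G%:E)%E <->
  (\int[mu]_(x in A) (`|u x| `^ p)%:E <= (G `^ p)%:E * mu A)%E.
Proof.
move=> p0 G0 /andP[mA0 mAy].
have mAf : mu A \is a fin_num by rewrite ge0_fin_numE// ltW.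
rewrite /pmean; set I := (\int[mu]_(x in A) _)%E.
have I0 : (0 <= I)%E by exact: integral_powR_ge0.
have m0 : 0 < fine (mu A) by rewrite fine_gt0// mA0.
rewrite -(fineK mAf) inver gt_eqF//.
set m := fine (mu A) in m0 *.
have -> : (I <= (G `^ p)%:E * m%:E)%E = ((m^-1)%:E * I <= (G `^ p)%:E)%E.
  by rewrite muleC -lee_pdivrMl.
set y := ((m^-1)%:E * I)%E.
have y0 : (0 <= y)%E by rewrite mule_ge0// lee_fin invr_ge0 ltW.
have inI (w : \bar R) : (0 <= w)%E -> w \in `[0%E, +oo%E] by move=> w0; rewrite in_itv/= w0 leey.
split=> h.
  have := @gt0_ler_poweR R p (ltW p0) _ _ (inI _ (poweR_ge0 _ _)) (inI _ _) h.
  by rewrite -poweRrM mulVf ?gt_eqF// poweRe1// => -> //; rewrite lee_fin.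
have pV : 0 <= p^-1 by rewrite invr_ge0 ltW.
have := @gt0_ler_poweR R p^-1 pV _ _ (inI _ y0) (inI _ _) h.
rewrite poweR_EFin -powRrM mulfV ?gt_eqF// powRr1//; apply.
by rewrite lee_fin powR_ge0.
Qed.

(** Lets the estimates, stated in the extended reals, be reduced to real arithmetic. *)
Lemma pmean_Lp A p u : 0 < p -> (0 < mu A < +oo)%E -> Lp_on mu A p u ->
  exists2 c, 0 <= c & pmean mu A p u = c%:E.
Proof.
move=> p0 /andP[mA0 mAy] [_ Iy].
have mAf : mu A \is a fin_num by rewrite ge0_fin_numE// ltW.
have uf : pmean mu A p u \is a fin_num.
  rewrite ge0_fin_numE ?pmean_ge0//; apply: poweR_lty.
  rewrite -(fineK mAf) inver gt_eqF; last by rewrite fine_gt0// mA0.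
  by apply: lte_mul_pinfty => //; rewrite lee_fin invr_ge0 fine_ge0// ltW.
exists (fine (pmean mu A p u)); first by rewrite fine_ge0// pmean_ge0.
by rewrite fineK.
Qed.

Lemma measurable_powR_norm A p u : measurable_fun A u ->
  measurable_fun A (fun x => (`|u x| `^ p)%:E).
Proof.
move=> mu_; apply/measurable_EFinP.
apply: (measurableT_comp (measurable_powR p)).
exact: measurableT_comp.
Qed.

Lemma measurable_superlevel A u (t : R) : measurable A -> measurable_fun A u ->
  measurable (A `&` [set x | t <= `|u x|]).
Proof.
move=> mA mu_.
have -> : [set x | t <= `|u x|] = (fun x => `|u x|) @^-1` `[t, +oo[%classic.
  by apply/seteqP; split => x /=; rewrite in_itv/= andbT.
have mn : measurable_fun A (fun x => `|u x|) by exact: measurableT_comp.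
exact: mn.
Qed.

Lemma Chebyshev_powR A p u t : measurable A -> measurable_fun A u -> 0 < p -> 0 < t ->
  ((t `^ p)%:E * mu (A `&` [set x | (t <= `|u x|)%R]) <=
   \int[mu]_(x in A) (`|u x| `^ p)%:E)%E.
Proof.
move=> mA mu_ p0 t0.
have mB := measurable_superlevel t mA mu_.
rewrite -(integral_cst mu mB (t `^ p)%:E).
apply: (@le_trans _ _ (\int[mu]_(x in A `&` [set x | (t <= `|u x|)%R]) (`|u x| `^ p)%:E)%E).
  apply: ge0_le_integral => //.
  - by move=> x _; rewrite lee_fin powR_ge0.
  - apply: measurable_powR_norm; apply: measurable_funS mu_ => // x [].
  - move=> x [_ /= tx]; rewrite lee_fin ge0_ler_powR// ?nnegrE ?(ltW t0)//.
    exact: ltW.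
apply: ge0_subset_integral => //.
exact: measurable_powR_norm.
Qed.

End MetricMeasureBasics.

(** * Descent through the sublevel sets of the gradient *)

Section PointwiseEstimates.
Context {R : realType} {d : measure_display} {X : borelMetricType R d}.
Variable mu : {measure set X -> \bar R}.
Hypothesis hX : metric_measure_space mu.
Implicit Types (x y z : X) (A B W N : set X) (u g : X -> R) (p s G : R).

Lemma mu_ball x r : 0 < r -> (0 < mu (ball x r) < +oo)%E.
Proof. by case: hX => _; apply. Qed.

Lemma mu_ball_fin x r : 0 < r -> mu (ball x r) \is a fin_num.
Proof. by move=> /(mu_ball x)/andP[m0 my]; rewrite ge0_fin_numE// ltW. Qed.

Lemma lower_bound_mass s kappa x y r r' : 0 < kappa ->
  measure_lower_bound mu s kappa ->
  ball x r `<=` ball y r' -> 0 < r -> r <= r' ->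
  (mu (ball y r') <= (kappa^-1 * (r' / r) `^ s)%:E * mu (ball x r))%E.
Proof.
move=> hkappa lower sub r0 rr'.
have r'0 : 0 < r' by apply: lt_le_trans rr'.
have := lower _ _ _ _ sub r0 rr'.
have /andP[W0 _] := mu_ball y r'0.
have Wf := mu_ball_fin y r'0.
have Bf := mu_ball_fin x r0.
have W0' : 0 < fine (mu (ball y r')) by rewrite fine_gt0// W0 ltey_eq Wf.
rewrite -(fineK Wf) -(fineK Bf) inver gt_eqF// -!EFinM !lee_fin.
rewrite ler_pdivlMr// !powR_div ?(ltW r0) ?(ltW r'0)// => h.
have rs : 0 < r `^ s by exact: powR_gt0.
have rs' : 0 < r' `^ s by exact: powR_gt0.
have c0 : 0 <= kappa^-1 * (r' `^ s / r `^ s) by rewrite mulr_ge0 ?divr_ge0 ?invr_ge0 ?ltW.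
apply: le_trans (ler_wpM2l c0 h).
by rewrite le_eqVlt; apply/orP; left; apply/eqP; field; rewrite !gt_eqF.
Qed.

(* [G] is only an upper bound of the mean of [g]: taking it positive avoids treating
   [g = 0] apart. *)
Definition grad_bound W p G u g N : Prop :=
  [/\ measurable_fun W g, forall x, W x -> 0 <= g x,
      (\int[mu]_(x in W) (`|g x| `^ p)%:E <= (G `^ p)%:E * mu W)%E,
      mu.-negligible N &
      forall x y, (W `\` N) x -> (W `\` N) y ->
        `|u x - u y| <= mdist x y * (g x + g y)].

(** Otherwise [A] lies, up to a null set, in the superlevel set [t <= |g|] of [W], whose mass is at
    most [(G / t) ^ p * mu W] by Chebyshev's inequality. *)
Lemma sublevel_point W A N p G t g : measurable W -> (mu W < +oo)%E ->
  measurable A -> A `<=` W -> mu.-negligible N -> measurable_fun W g ->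
  0 < p -> 0 < t -> 0 <= G ->
  (\int[mu]_(x in W) (`|g x| `^ p)%:E <= (G `^ p)%:E * mu W)%E ->
  (((G / t) `^ p)%:E * mu W < mu A)%E ->
  exists x, [/\ A x, ~ N x & g x <= t].
Proof.
move=> mW Wfin mA AW [M [mM muM NM]] mg p0 t0 G0 Ig; apply: contraPP.
move=> /forallNP nox; apply/negP; rewrite -leNgt.
pose B := W `&` [set x | t <= `|g x|].
have tp0 : 0 < t `^ p by exact: powR_gt0.
have Wf : mu W \is a fin_num by rewrite ge0_fin_numE.
have mB : measurable B by exact: measurable_superlevel.
have AB : A `<=` M `|` B.
  move=> x Ax; have [Mx|nMx] := pselect (M x); first by left.
  right; split; first exact: AW.
  have : ~ [/\ A x, ~ N x & g x <= t] by exact: nox.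
  have [gt|tg _ /=] := leP (g x) t.
    by case=> //; split=> // /NM.
  by apply: le_trans (ltW tg) (ler_norm _).
have muAB : (mu A <= mu B)%E.
  apply: (@le_trans _ _ (mu (M `|` B))).
    by apply: le_measure; rewrite ?inE//; exact: measurableU.
  by have := measureU2 mu mM mB; rewrite [X in (_ <= X + _)%E -> _]muM add0e.
apply: (le_trans muAB).
have := le_trans (Chebyshev_powR mu mW mg p0 t0) Ig.
rewrite -/B -(fineK Wf) muleC -lee_pdivlMr// => /le_trans; apply.
by rewrite powR_div ?(ltW t0)// -!EFinM lee_fin mulrAC.
Qed.

Section Chain.
Variables (sigma s kappa p q rho L : R).
Hypotheses (hsigma : 1 < sigma) (hp : 0 < p).
Hypothesis lower : measure_lower_bound mu s kappa.
Hypotheses (q0 : 0 < q) (q1 : q < 1) (qE : q `^ s = 4 `^ (- p)).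
Hypothesis rhoE : rho = (sigma - 1) * (1 - q).
Hypotheses (L0 : 0 < L) (hL : L `^ (- p) < kappa * (rho / sigma) `^ s).

Let sigma0 : 0 < sigma. Proof. by apply: lt_trans hsigma. Qed.
Let rho0 : 0 < rho. Proof. by rewrite rhoE mulr_gt0 ?subr_gt0. Qed.

(* [R0 * rho * q ^+ n] is the radius from which a ball in [W] must meet the sublevel set
   [g <= 4 ^+ n * (G * L)]; the choice of [rho] keeps the whole chain inside [W]. *)
Lemma sublevel_chain x0 R0 u g N G n x : 0 < R0 -> 0 < G ->
  grad_bound (ball x0 (sigma * R0)) p G u g N ->
  (ball x0 (sigma * R0) `\` N) x -> g x <= 4 ^+ n * (G * L) ->
  mdist x0 x + R0 * rho * (\sum_(i < n) q ^+ i) <= sigma * R0 ->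
  exists z, [/\ (ball x0 (sigma * R0) `\` N) z, g z <= G * L &
    `|u x - u z| <= 5 * R0 * rho * (G * L) * \sum_(i < n) (4 * q) ^+ i].
Proof.
move=> R00 G0 [mg g0 Ig Nn ug]; set W := ball x0 (sigma * R0).
have sR0 : 0 < sigma * R0 by rewrite mulr_gt0.
elim: n x => [|n IHn] x Wx gx dx.
  exists x; split=> //; first by rewrite expr0 mul1r in gx.
  by rewrite subrr normr0 big_ord0 mulr0.
rewrite big_ord_recr/= mulrDr in dx.
have qn0 : 0 < q ^+ n by rewrite exprn_gt0.
have S0 : 0 <= \sum_(i < n) q ^+ i by apply: sumr_ge0 => i _; rewrite exprn_ge0// ltW.
pose r := R0 * rho * q ^+ n.
have r0 : 0 < r by rewrite !mulr_gt0.
have RS0 : 0 <= R0 * rho * \sum_(i < n) q ^+ i by rewrite !mulr_ge0// ltW.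
have xrW : ball x r `<=` W by apply: sub_ball; rewrite -/r in dx; lra.
have rsR : r <= sigma * R0 by have := mdist_ge0 x0 x; rewrite -/r in dx; lra.
have t0 : 0 < 4 ^+ n * (G * L) by rewrite !mulr_gt0// exprn_gt0.
have /andP[W0 Wy] := mu_ball x0 sR0.
have Wf := mu_ball_fin x0 sR0.
have W0' : 0 < fine (mu W) by rewrite fine_gt0// W0.
have [|y [xy Ny gy]] := @sublevel_point W (ball x r) N p G (4 ^+ n * (G * L)) g
    (measurable_metric_ball _ _) Wy (measurable_metric_ball _ _) xrW Nn mg hp t0 (ltW G0) Ig.
  (* The lower bound gives the ball at least the share [kappa * (rho / sigma) ^ s * q ^ (n * s)] of
     the mass of [W], and Chebyshev's inequality asks for more than [4 ^ (- n * p) * L ^ (- p)].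
     Since [q ^ s = 4 ^ (- p)], the powers with exponent [n] cancel and [hL] concludes for every [n]
     at once. *)
  have := lower xrW r0 rsR; rewrite -/W.
  rewrite -(fineK Wf) inver gt_eqF// lee_pdivlMr//.
  apply: lt_le_trans; rewrite -EFinM lte_fin ltr_pM2r//.
  have -> : G / (4 ^+ n * (G * L)) = (4 ^+ n)^-1 * L^-1.
    by field; rewrite !gt_eqF ?exprn_gt0//.
  have -> : r / (sigma * R0) = q ^+ n * (rho / sigma) by rewrite /r; field; rewrite !gt_eqF.
  rewrite (@powRM _ (4 ^+ n)^-1) ?invr_ge0 ?exprn_ge0 ?(ltW L0)//.
  rewrite (@powRM _ (q ^+ n)) ?exprn_ge0 ?divr_ge0 ?(ltW q0) ?(ltW rho0) ?(ltW sigma0)//.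
  rewrite -[L^-1]powR_inv1 ?ltW// -powRrM mulN1r.
  have -> : (4 ^+ n)^-1 `^ p = (q ^+ n) `^ s.
    rewrite powR_inv ?exprn_ge0// -[4 ^+ n]powR_mulrn// -[q ^+ n]powR_mulrn ?(ltW q0)//.
    by rewrite [RHS]powRAC qE -powRN -!powRrM; congr (_ `^ _); ring.
  by rewrite mulrCA ltr_pM2l// powR_gt0// exprn_gt0.
have Wy' : (W `\` N) y by split=> //; exact: xrW.
have dxy : mdist x y < r by exact/in_ballP.
have [|z [Wz gz uyz]] := IHn _ Wy' gy.
  by have := metric_triangle x0 x y; rewrite -/r in dx; lra.
exists z; split=> //.
(* [5 = 4 + 1]: [x] is on the level [n.+1] and [y] on the level [n]. *)
have : `|u x - u y| <= r * (5 * (4 ^+ n * (G * L))).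
  apply: (le_trans (ug _ _ Wx Wy')); apply: ler_pM => //.
  - exact: mdist_ge0.
  - by rewrite addr_ge0// g0//; [case: Wx|case: Wy'].
  - exact: ltW.
  - by move: gx; rewrite exprS; lra.
have -> : u x - u z = (u x - u y) + (u y - u z) by ring.
move=> uxy; apply: (le_trans (ler_normD _ _)); apply: (le_trans (lerD uxy uyz)).
rewrite big_ord_recr/= mulrDr addrC lerD2l /r exprMn.
by rewrite le_eqVlt; apply/orP; left; apply/eqP; ring.
Qed.

End Chain.
End PointwiseEstimates.

Section Oscillation.
Context {R : realType} {d : measure_display} {X : borelMetricType R d}.
Variable mu : {measure set X -> \bar R}.
Hypothesis hX : metric_measure_space mu.
Implicit Types (x y z : X) (A B W N : set X) (u g : X -> R).
Variables (sigma s kappa p : R).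
Hypotheses (hsigma : 1 < sigma) (hs : 0 < s) (hp : 0 < p) (hkappa : 0 < kappa).
Hypothesis lower : measure_lower_bound mu s kappa.

Let sigma0 : 0 < sigma. Proof. by apply: lt_trans hsigma. Qed.

Lemma sublevel_lip x0 R0 u g N G t x y : 0 < R0 -> 0 < G ->
  grad_bound mu (ball x0 (sigma * R0)) p G u g N ->
  (ball x0 (sigma * R0) `\` N) x -> g x <= t ->
  (ball x0 (sigma * R0) `\` N) y -> g y <= t ->
  `|u x - u y| <= 4 * sigma * R0 * t.
Proof.
move=> R00 G0 [_ g0 _ _ ug] Wx gx Wy gy; apply: (le_trans (ug _ _ Wx Wy)).
have dx : mdist x0 x < sigma * R0 by case: Wx => /in_ballP.
have dy : mdist x0 y < sigma * R0 by case: Wy => /in_ballP.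
have -> : 4 * sigma * R0 * t = (2 * (sigma * R0)) * (2 * t) by ring.
apply: ler_pM.
- exact: mdist_ge0.
- by rewrite addr_ge0// g0//; [case: Wx|case: Wy].
- by have := metric_triangle x x0 y; rewrite (metric_sym x x0); lra.
- lra.
Qed.

Lemma geometric_sum (q : R) n : (1 - q) * \sum_(i < n) q ^+ i = 1 - q ^+ n.
Proof. by rewrite -[RHS]opprB subrX1 -mulNr opprB. Qed.

Lemma powRN_small (c : R) : 0 < c -> exists2 L : R, 1 <= L & L `^ (- p) < c.
Proof.
move=> c0; pose M := 1 + c^-1.
have cV0 : 0 < c^-1 by rewrite invr_gt0.
have M1 : 1 <= M by rewrite /M; lra.
have M0 : 0 < M by lra.
exists (M `^ p^-1).
  by rewrite -[leLHS](powRr0 M) ler_powR// invr_ge0 ltW.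
rewrite -powRrM mulrN mulVf ?gt_eqF// powR_inv1 ?(ltW M0)//.
by rewrite invf_plt ?posrE// /M; lra.
Qed.

(** Fixes the parameters of the chain: [q = 4 ^ (- p / s)], then [rho], then [L]. Besides the
    smallness needed by the chain, [L ^ (- p) < 1 / 2] is imposed so that two superlevel sets, one
    of [g] and one of [u], can later be avoided simultaneously. *)
Lemma sublevel_descent : exists L K : R, [/\ 1 <= L, L `^ (- p) < 2^-1, 0 < K &
  forall x0 R0 u g N G n x, 0 < R0 -> 0 < G ->
    grad_bound mu (ball x0 (sigma * R0)) p G u g N ->
    (ball x0 R0 `\` N) x -> g x <= 4 ^+ n * (G * L) ->
    exists z, [/\ (ball x0 (sigma * R0) `\` N) z, g z <= G * L &
      `|u x - u z| <= K * R0 * G * \sum_(i < n) (4 * 4 `^ (- (p / s))) ^+ i]].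
Proof.
pose q : R := 4 `^ (- (p / s)).
have q0 : 0 < q by exact: powR_gt0.
have q1 : q < 1.
  rewrite /q powRN invf_lt1 ?powR_gt0//.
  have := @gt0_ltr_powR R (p / s) (divr_gt0 hp hs) 1 4.
  by rewrite powR1; apply; rewrite ?nnegrE//; lra.
have qE : q `^ s = 4 `^ (- p).
  by rewrite -powRrM; congr (_ `^ _); field; rewrite gt_eqF.
have [rho rhoE] : exists rho, rho = (sigma - 1) * (1 - q) by eexists.
have rho0 : 0 < rho by rewrite rhoE mulr_gt0 ?subr_gt0.
have c0 : 0 < kappa * (rho / sigma) `^ s.
  by rewrite mulr_gt0// powR_gt0// divr_gt0.
pose c := Num.min (kappa * (rho / sigma) `^ s) 2^-1.
have [|L L1] := @powRN_small c; first by rewrite lt_min c0 /=; lra.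
rewrite lt_min => /andP[Lc L2].
have L0 : 0 < L by lra.
exists L, (5 * rho * L); split=> //; [by rewrite mulr_gt0// mulr_gt0|].
move=> x0 R0 u g N G n x R00 G0 Wg [Bx Nx] gx.
have dx : mdist x0 x < R0 by exact/in_ballP.
have [||z [Wz gz uz]] :=
    sublevel_chain hX hsigma hp lower q0 q1 qE rhoE L0 Lc R00 G0 Wg _ gx.
- split=> //; apply: (@sub_ball _ _ _ _ x0 R0) Bx.
  by rewrite mdistxx add0r ler_peMl// ltW.
(* The radii of the whole chain add up to less than [(sigma - 1) * R0], the gap between [B0] and its
   dilate. *)
- have -> : R0 * rho * \sum_(i < n) q ^+ i = R0 * (sigma - 1) * (1 - q ^+ n).
    have -> : 1 - q ^+ n = (1 - q) * \sum_(i < n) q ^+ i.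
      by rewrite geometric_sum.
    by rewrite rhoE !mulrA.
  have : 0 < R0 * (sigma - 1) * q ^+ n by rewrite !mulr_gt0 ?subr_gt0 ?exprn_gt0.
  lra.
exists z; split=> //.
by have <- : 5 * R0 * rho * (G * L) = 5 * rho * L * R0 * G by ring.
Qed.

Lemma exp4_unbounded (a b : R) : 0 < b -> exists n, a <= 4 ^+ n * b.
Proof.
move=> b0; exists (Num.bound `|a / b|).
rewrite -ler_pdivrMr//; apply: le_trans (ler_norm _) _.
apply: le_trans (ltW (archi_boundP (normr_ge0 _))) _.
by rewrite -natrX ler_nat ltnW// ltn_expl.
Qed.

(** For [p > s] the ratio [Q = 4 ^ (1 - p / s)] is below 1, so the descents from [x] and from [y]
    cost a bounded amount, however many levels they cross. Their end points lie in the lowest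
    sublevel set, where [u] is Lipschitz. *)
Lemma osc_le : s < p -> exists2 C : R, 0 < C &
  forall x0 R0 u g N G x y, 0 < R0 -> 0 < G ->
    grad_bound mu (ball x0 (sigma * R0)) p G u g N ->
    (ball x0 R0 `\` N) x -> (ball x0 R0 `\` N) y -> `|u x - u y| <= C * R0 * G.
Proof.
move=> sp; have [L [K [L1 _ K0 descent]]] := sublevel_descent.
have L0 : 0 < L by lra.
pose Q : R := 4 * 4 `^ (- (p / s)).
have Q0 : 0 < Q by rewrite mulr_gt0// powR_gt0.
have Q1 : Q < 1.
  have ps : 1 < p / s by rewrite ltr_pdivlMr// mul1r.
  rewrite /Q powRN ltr_pdivrMr ?powR_gt0// mul1r.
  rewrite -[ltLHS](@powRr1 R 4)// /powR gt_eqF// ltr_expR ltr_pM2r// ln_gt0//.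
  by lra.
have S n : \sum_(i < n) Q ^+ i <= (1 - Q)^-1.
  rewrite -[leRHS]mul1r ler_pdivlMr ?subr_gt0// mulrC.
  have -> : (1 - Q) * \sum_(i < n) Q ^+ i = 1 - Q ^+ n.
    exact: geometric_sum.
  by rewrite gerBl exprn_ge0// ltW.
exists (2 * K / (1 - Q) + 4 * sigma * L).
  by rewrite addr_gt0 ?divr_gt0 ?mulr_gt0 ?subr_gt0.
move=> x0 R0 u g N G x y R00 G0 Wg Bx By.
have GL0 : 0 < G * L by rewrite mulr_gt0.
have [n gx] := exp4_unbounded (g x) GL0.
have [m gy] := exp4_unbounded (g y) GL0.
have [x' [Wx' gx' ux]] := descent _ _ _ _ _ _ _ _ R00 G0 Wg Bx gx.
have [y' [Wy' gy' uy]] := descent _ _ _ _ _ _ _ _ R00 G0 Wg By gy.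
have KRG : 0 < K * R0 * G by rewrite !mulr_gt0.
have ux' : `|u x - u x'| <= K * R0 * G / (1 - Q) by apply: (le_trans ux); rewrite ler_pM2l.
have uy' : `|u y - u y'| <= K * R0 * G / (1 - Q) by apply: (le_trans uy); rewrite ler_pM2l.
have uxy := sublevel_lip R00 G0 Wg Wx' gx' Wy' gy'.
have -> : u x - u y = (u x - u x') + (u x' - u y') - (u y - u y') by ring.
apply: (le_trans (ler_normB _ _)).
apply: (le_trans (lerD (ler_normD _ _) (lexx _))).
suff -> : (2 * K / (1 - Q) + 4 * sigma * L) * R0 * G =
  K * R0 * G / (1 - Q) + 4 * sigma * R0 * (G * L) + K * R0 * G / (1 - Q).
  by rewrite !lerD.
by field; rewrite gt_eqF// subr_gt0.
Qed.

End Oscillation.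

(** * Sobolev estimates from the lower bound *)

Section SobolevFromLowerBound.
Context {R : realType} {d : measure_display} {X : borelMetricType R d}.
Variable mu : {measure set X -> \bar R}.
Hypothesis hX : metric_measure_space mu.
Implicit Types (x y z : X) (A B W N : set X) (u g : X -> R).
Variables (sigma s kappa : R).
Hypotheses (hsigma : 1 < sigma) (hs : 0 < s) (hkappa : 0 < kappa).
Hypothesis lower : measure_lower_bound mu s kappa.

Let sigma0 : 0 < sigma. Proof. by apply: lt_trans hsigma. Qed.
Let p : R := s / 2.
Let p0 : 0 < p. Proof. by rewrite divr_gt0. Qed.
Let ps : p < s. Proof. by rewrite ltr_pdivrMr// ltr_pMr// ltr1n. Qed.

(** For [p = s / 2] the ratio of the series is exactly 2, so a descent through [n] levels costs
    about [2 ^ n], the square root of the height [4 ^ n] of its starting level. *)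
Lemma sqrt_growth : exists L C : R, [/\ 1 <= L, L `^ (- p) < 2^-1, 0 < C &
  forall x0 R0 u g N G x z, 0 < R0 -> 0 < G ->
    grad_bound mu (ball x0 (sigma * R0)) p G u g N ->
    (ball x0 R0 `\` N) x -> (ball x0 (sigma * R0) `\` N) z -> g z <= G * L ->
    `|u x - u z| <= C * R0 * G * (1 + (g x / G) `^ 2^-1)].
Proof.
have [L [K [L1 L2 K0 descent]]] := sublevel_descent hX hsigma hs p0 hkappa lower.
have L0 : 0 < L by lra.
exists L, (2 * K + 4 * sigma * L); split=> //.
  by rewrite addr_gt0 ?mulr_gt0.
move=> x0 R0 u g N G x z R00 G0 Wg Bx Wz gz.
have GL0 : 0 < G * L by rewrite mulr_gt0.
have Q2 : 4 * 4 `^ (- (p / s)) = 2 :> R.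
  have -> : p / s = 2^-1 by rewrite /p; field; rewrite gt_eqF.
  rewrite powRN powR12_sqrt//.
  have -> : 4 = 2 ^+ 2 :> R by ring.
  by rewrite sqrtr_sqr ger0_norm//; field.
have gx0 : 0 <= g x.
  case: Wg => _ g0 _ _ _; apply: g0; apply: (@sub_ball _ _ _ _ x0 R0); last by case: Bx.
  by rewrite mdistxx add0r ler_peMl// ltW.
have g_sqrt0 : 0 <= (g x / G) `^ 2^-1 by exact: powR_ge0.
(* Take the least [n]. If it is positive, the level below fails, so [4 ^ (n - 1) * G <= g x] because
   [L >= 1]; take square roots. *)
have [n gx n_le] : exists2 n, g x <= 4 ^+ n * (G * L) & 2 ^+ n <= 1 + 2 * (g x / G) `^ 2^-1.
  have : exists n, g x <= 4 ^+ n * (G * L) by exact: exp4_unbounded.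
  move=> ex; case: (ex_minnP ex) => -[|n] gn minn.
    by exists 0%N => //; rewrite expr0; lra.
  exists n.+1 => //; rewrite exprS.
  suff : 2 ^+ n <= (g x / G) `^ 2^-1 by lra.
  have ltn : 4 ^+ n * (G * L) < g x.
    by rewrite ltNge; apply/negP => /minn; rewrite ltnn.
  have -> : 2 ^+ n = (4 ^+ n) `^ 2^-1 :> R.
    rewrite powR12_sqrt ?exprn_ge0//.
    have -> : 4 = 2 ^+ 2 :> R by ring.
    by rewrite exprAC sqrtr_sqr ger0_norm// exprn_ge0.
  apply: ge0_ler_powR; rewrite ?nnegrE ?divr_ge0 ?exprn_ge0 ?(ltW G0)//.
  rewrite ler_pdivlMr//; apply: le_trans (ltW ltn).
  by rewrite ler_pM2l ?exprn_gt0// ler_peMr// ltW.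
have [x' [Wx' gx' ux]] := descent _ _ _ _ _ _ _ _ R00 G0 Wg Bx gx.
have uxz := sublevel_lip R00 G0 Wg Wx' gx' Wz gz.
have KRG : 0 < K * R0 * G by rewrite !mulr_gt0.
have sum2 : \sum_(i < n) (4 * 4 `^ (- (p / s))) ^+ i <= 1 + 2 * (g x / G) `^ 2^-1 :> R.
  apply: le_trans n_le; rewrite Q2.
  have := geometric_sum (2 : R) n.
  have : 0 < 2 ^+ n :> R by exact: exprn_gt0.
  lra.
have ux' : `|u x - u x'| <= K * R0 * G * (1 + 2 * (g x / G) `^ 2^-1).
  by apply: (le_trans ux); rewrite ler_pM2l.
have -> : u x - u z = (u x - u x') + (u x' - u z) by ring.
apply: (le_trans (ler_normD _ _)); apply: (le_trans (lerD ux' uxz)).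
have : 0 <= 4 * sigma * R0 * (G * L) * (g x / G) `^ 2^-1.
  by rewrite mulr_ge0// !mulr_ge0// ltW.
move: ((g x / G) `^ 2^-1) KRG => r KRG; lra.
Qed.

(** As [s / 2 = p], the power [s] of the square root of [g / G] is [(g / G) ^ p], whose integral
    over [W] is at most [mu W], hence at most [D * mu B]. *)
Lemma pmean_sqrt_growth B W N G H D (w g : X -> R) :
  measurable B -> measurable W -> B `<=` W -> (0 < mu B < +oo)%E ->
  (mu W <= D%:E * mu B)%E -> 0 < G -> 0 <= H -> 0 <= D ->
  measurable_fun B w -> measurable_fun W g -> (forall x, W x -> 0 <= g x) ->
  (\int[mu]_(x in W) (`|g x| `^ p)%:E <= (G `^ p)%:E * mu W)%E ->
  mu.-negligible N ->
  (forall x, (B `\` N) x -> `|w x| <= H * (1 + (g x / G) `^ 2^-1)) ->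
  (pmean mu B s w <= (2 * H * (1 + D) `^ s^-1)%:E)%E.
Proof.
move=> mB mW BW muB WD G0 H0 D0 mw mg g0 Ig [M [mM muM NM]] wg.
have mgB : measurable_fun B g by apply: measurable_funS mg.
have Gp0 : 0 < G `^ p by exact: powR_gt0.
have c0 : 0 <= (2 * H) `^ s by exact: powR_ge0.
apply/pmean_le => //; first by rewrite !mulr_ge0// powR_ge0.
rewrite powRM ?mulr_ge0 ?powR_ge0// -powRrM mulVf ?gt_eqF// powRr1 ?addr_ge0//.
apply: (@le_trans _ _ (\int[mu]_(x in B)
    (((2 * H) `^ s)%:E * (1%:E + ((G `^ p)^-1)%:E * (`|g x| `^ p)%:E)))%E).
  apply: ae_ge0_le_integral => //.
  - exact: measurable_powR_norm.
  - move=> x _; rewrite mule_ge0// adde_ge0// mule_ge0// lee_fin ?powR_ge0//.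
    by rewrite invr_ge0 ltW.
  - apply: measurable_funeM; apply: emeasurable_funD => //.
    by apply: measurable_funeM; exact: measurable_powR_norm.
  exists M; split=> // x /=; apply: contra_notP => nMx Bx.
  rewrite -!EFinM lee_fin.
  have gx0 : 0 <= g x by exact/g0/BW.
  have -> : (G `^ p)^-1 * `|g x| `^ p = ((g x / G) `^ 2^-1) `^ s.
    by rewrite ger0_norm// -powRrM [2^-1 * s]mulrC -/p powR_div ?(ltW G0)// mulrC.
  have : `|w x| <= H * (1 + (g x / G) `^ 2^-1) by apply: wg; split=> // /NM.
  have := powR_ge0 (g x / G) 2^-1.
  move: ((g x / G) `^ 2^-1) => r r0 wr.
  have rs0 := powR_ge0 r s.
  (* [1 + r] is at most [2] or at most [2 * r]. This gives [(1 + r) ^ s <= 2 ^ s * (1 + r ^ s)] for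
     every positive [s], with no convexity. *)
  have [r1|/ltW r1] := leP r 1.
    apply: (@le_trans _ _ ((2 * H) `^ s)); last by rewrite ler_peMr//; lra.
    apply: ge0_ler_powR; rewrite ?nnegrE ?mulr_ge0 ?(ltW hs)//.
    by apply: (le_trans wr); rewrite [2 * H]mulrC ler_wpM2l//; lra.
  apply: (@le_trans _ _ ((2 * H * r) `^ s)).
    apply: ge0_ler_powR; rewrite ?nnegrE ?mulr_ge0 ?(ltW hs)//.
    apply: (le_trans wr); rewrite [2 * H]mulrC -mulrA ler_wpM2l//; lra.
  by rewrite powRM ?mulr_ge0// ler_wpM2l//; lra.
rewrite ge0_integralZl_EFin//; last 2 first.
- move=> x _; rewrite adde_ge0// mule_ge0// lee_fin ?powR_ge0//.
  by rewrite invr_ge0 ltW.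
- apply: emeasurable_funD => //.
  by apply: measurable_funeM; exact: measurable_powR_norm.
rewrite ge0_integralD//; last 2 first.
- by move=> x _; rewrite mule_ge0// lee_fin ?powR_ge0// invr_ge0 ltW.
- by apply: measurable_funeM; exact: measurable_powR_norm.
rewrite ge0_integralZl_EFin//; last 2 first.
- exact: measurable_powR_norm.
- by rewrite invr_ge0 ltW.
rewrite (integral_cst mu mB 1%:E) mul1e EFinM -muleA.
apply: lee_wpmul2l; first by rewrite lee_fin.
rewrite EFinD ge0_muleDl ?lee_fin// mul1e.
rewrite leeD2l//.
apply: le_trans WD.
have Gpf : (0 < (G `^ p)%:E)%E by rewrite lte_fin.
have -> : (mu W = ((G `^ p)^-1)%:E * ((G `^ p)%:E * mu W))%E.
  by rewrite muleA -EFinM mulVf ?gt_eqF// mul1e.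
apply: lee_wpmul2l; first by rewrite lee_fin invr_ge0 ltW.
apply: le_trans Ig.
apply: ge0_subset_integral => //.
by apply: measurable_powR_norm.
Qed.

Lemma lower_bound_dilation x0 R0 : 0 < R0 ->
  (mu (ball x0 (sigma * R0)) <= (kappa^-1 * sigma `^ s)%:E * mu (ball x0 R0))%E.
Proof.
move=> R00.
have sR0 : 0 < sigma * R0 by rewrite mulr_gt0.
have RsR : R0 <= sigma * R0 by rewrite ler_peMl// ltW.
have sub : ball x0 R0 `<=` ball x0 (sigma * R0).
  by apply: sub_ball; rewrite mdistxx add0r.
have := lower_bound_mass hX hkappa lower sub R00 RsR.
by rewrite mulfK ?gt_eqF.
Qed.


Lemma sobolev_exponent_half : sobolev_exponent s p = s.
Proof.
rewrite /sobolev_exponent /p; have -> : s - s / 2 = s / 2 by lra.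
by field; rewrite gt_eqF.
Qed.

(** Common source of both Sobolev estimates: [c = u z] with [T = 0] gives the Sobolev-Poincare
    estimate, and [c = 0] with [T] a bound of [|u z|] gives the other one. *)
Lemma sqrt_pmean : exists L C : R, [/\ 1 <= L, L `^ (- p) < 2^-1, 0 < C &
  forall x0 R0 u g N G z c T, 0 < R0 -> 0 < G ->
    grad_bound mu (ball x0 (sigma * R0)) p G u g N ->
    (ball x0 (sigma * R0) `\` N) z -> g z <= G * L ->
    measurable_fun (ball x0 (sigma * R0)) u -> `|u z - c| <= T ->
    (pmean mu (ball x0 R0) s (fun x => (u x - c)%R) <= (C * (R0 * G + T))%:E)%E].
Proof.
have [L [C [L1 L2 C0 growth]]] := sqrt_growth.
pose D := kappa^-1 * sigma `^ s.
have D0 : 0 < D by rewrite mulr_gt0 ?invr_gt0 ?powR_gt0.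
have D1 : 0 < 2 * (1 + D) `^ s^-1 by rewrite mulr_gt0// powR_gt0// addr_gt0.
exists L, (2 * (1 + D) `^ s^-1 * (C + 1)); split=> //.
  by rewrite mulr_gt0// addr_gt0.
move=> x0 R0 u g N G z c T R00 G0 Wg Wz gz mu_ uzc.
have T0 : 0 <= T by apply: le_trans uzc.
have BW : ball x0 R0 `<=` ball x0 (sigma * R0).
  by apply: sub_ball; rewrite mdistxx add0r ler_peMl// ltW.
have CRG : 0 < C * R0 * G by rewrite !mulr_gt0.
have [mg g0 Ig Nn ug] := Wg.
apply: (@le_trans _ _ (2 * (C * R0 * G + T) * (1 + D) `^ s^-1)%:E).
  apply: (@pmean_sqrt_growth _ _ N G (C * R0 * G + T) D _ g
    (measurable_metric_ball _ _) (measurable_metric_ball _ _) BW (mu_ball hX _ R00)) => //.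
  - exact: lower_bound_dilation.
  - by rewrite addr_ge0// ltW.
  - exact: ltW.
  - by apply: measurable_funB => //; apply: measurable_funS mu_ => //; exact: measurable_metric_ball.
  move=> x Bx.
  have := growth _ _ _ _ _ _ _ _ R00 G0 Wg Bx Wz gz.
  have := powR_ge0 (g x / G) 2^-1.
  move: ((g x / G) `^ 2^-1) => r r0 uxz.
  have -> : u x - c = (u x - u z) + (u z - c) by ring.
  apply: (le_trans (ler_normD _ _)); apply: (le_trans (lerD uxz uzc)).
  have : 0 <= T * r by rewrite mulr_ge0.
  lra.
rewrite lee_fin.
have -> : 2 * (C * R0 * G + T) * (1 + D) `^ s^-1 = 2 * (1 + D) `^ s^-1 * (C * R0 * G + T) by ring.
rewrite -[leRHS]mulrA ler_pM2l//.
have : 0 <= C * T by rewrite mulr_ge0// ltW.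
have : 0 < R0 * G by rewrite mulr_gt0.
lra.
Qed.

Lemma grad_bound_hajlasz W u g G : 0 <= G -> (0 < mu W < +oo)%E ->
  hajlasz_gradient mu W p u g -> (pmean mu W p g <= G%:E)%E ->
  exists N, grad_bound mu W p G u g N.
Proof.
move=> G0 mW [g0 [mg _] [N [NW Nn ug]]] gG; exists N; split=> //.
exact/pmean_le.
Qed.

Lemma sobolev_poincare_of_lower_bound :
  exists p C : R, [/\ 0 < p < s, 0 < C & sobolev_poincare_estimate mu sigma s p C].
Proof.
have [L [C [L1 L2 C0 est]]] := sqrt_pmean.
exists p, C; split=> //; first by rewrite p0 ps.
move=> x0 R0 R00 u g [[mu_ Iu] _] Dg.
have sR0 : 0 < sigma * R0 by rewrite mulr_gt0.
set W := ball x0 (sigma * R0).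
have mW := mu_ball hX x0 sR0; have Wf := mu_ball_fin hX x0 sR0.
have Lg : Lp_on mu W p g by case: Dg.
have [G0 g0 gE] := pmean_Lp p0 mW Lg.
rewrite sobolev_exponent_half gE.
apply/lee_addgt0Pr => e e0.
have CR0 : 0 < C * R0 by rewrite mulr_gt0.
(* A positive bound even if the mean of [g] vanishes; the excess contributes exactly [e] to the
   final estimate. *)
pose G := G0 + e / (C * R0).
have G_gt0 : 0 < G by rewrite ltr_wpDl// divr_gt0.
have gG : (pmean mu W p g <= G%:E)%E.
  by rewrite gE lee_fin lerDl divr_ge0// ltW.
have [N Wg] := grad_bound_hajlasz (ltW G_gt0) mW Dg gG.
have [mg _ Ig Nn _] := Wg.
have mmW : measurable W := measurable_metric_ball _ _.
have GL0 : 0 < G * L by rewrite mulr_gt0//; lra.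
case/andP: (mW) => W0 Wy.
have [|z [Wz Nz gz]] := sublevel_point mmW Wy mmW (@subset_refl _ W) Nn mg p0 GL0 (ltW G_gt0) Ig.
  rewrite -(fineK Wf) -EFinM lte_fin gtr_pMl ?fine_gt0 ?W0//.
  have -> : G / (G * L) = L^-1 by field; rewrite !gt_eqF//; lra.
  by rewrite powR_inv -?powRN; lra.
have := est _ _ _ _ _ _ _ (u z) 0 R00 G_gt0 Wg (conj Wz Nz) gz mu_.
rewrite subrr normr0 addr0 => /(_ (lexx 0)) h.
apply: ge_ereal_inf; exists (pmean mu (ball x0 R0) s (fun x => u x - u z)).
  by exists (u z).
apply: (le_trans h); rewrite -EFinM -EFinD lee_fin /G.
by rewrite le_eqVlt; apply/orP; left; apply/eqP; field; rewrite !gt_eqF.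
Qed.

(** The anchor [z] must have both [g z <= G * L] and [|u z| <= U * L]. Each condition fails on less
    than half of the mass of [W], because [L ^ (- p) < 1 / 2], so such a point exists. *)
Lemma sobolev_of_lower_bound :
  exists p C : R, [/\ 0 < p < s, 0 < C & sobolev_estimate mu sigma s p C].
Proof.
have [L [C [L1 L2 C0 est]]] := sqrt_pmean.
have L0 : 0 < L by lra.
exists p, (C * (1 + L)); split=> //; first by rewrite p0 ps.
  by rewrite mulr_gt0// addr_gt0.
move=> x0 R0 R00 u g [Lu _] Dg.
have sR0 : 0 < sigma * R0 by rewrite mulr_gt0.
set W := ball x0 (sigma * R0) in Lu Dg *.
have mW := mu_ball hX x0 sR0; have Wf := mu_ball_fin hX x0 sR0.
have Lg : Lp_on mu W p g by case: Dg.
have [G0 g0 gE] := pmean_Lp p0 mW Lg.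
have [U0 u0 uE] := pmean_Lp p0 mW Lu.
have [mu_ _] := Lu.
rewrite sobolev_exponent_half gE uE.
apply/lee_addgt0Pr => e e0.
have CR0 : 0 < C * (1 + L) * (R0 + 1) by rewrite !mulr_gt0// addr_gt0.
(* [e'] is added to both means, with weights [C * (1 + L) * R0] and [C * (1 + L)]; the total excess
   is [e]. *)
pose e' := e / (C * (1 + L) * (R0 + 1)).
have e'0 : 0 < e' by rewrite divr_gt0.
pose G := G0 + e'; pose U := U0 + e'.
have G_gt0 : 0 < G by rewrite ltr_wpDl.
have U_gt0 : 0 < U by rewrite ltr_wpDl.
have gG : (pmean mu W p g <= G%:E)%E by rewrite gE lee_fin lerDl ltW.
have uU : (pmean mu W p u <= U%:E)%E by rewrite uE lee_fin lerDl ltW.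
have [N Wg] := grad_bound_hajlasz (ltW G_gt0) mW Dg gG.
have [mg _ Ig Nn _] := Wg.
have mmW : measurable W := measurable_metric_ball _ _.
have GL0 : 0 < G * L by rewrite mulr_gt0.
have UL0 : 0 < U * L by rewrite mulr_gt0.
case/andP: (mW) => W0 Wy.
pose B := W `&` [set x | U * L <= `|u x|].
have mB : measurable B by exact: measurable_superlevel.
have W0' : 0 < fine (mu W) by rewrite fine_gt0// W0.
have LE t : 0 < t -> (t / (t * L)) `^ p = L `^ (- p).
  move=> t0; have -> : t / (t * L) = L^-1 by field; rewrite !gt_eqF.
  by rewrite powR_inv -?powRN// ltW.
have muB : (mu B <= (L `^ (- p))%:E * mu W)%E.
  have /pmean_le Iu := uU.
  have := le_trans (Chebyshev_powR mu mmW mu_ p0 UL0) (Iu p0 (ltW U_gt0) mW).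
  have ULp : 0 < (U * L) `^ p by exact: powR_gt0.
  rewrite -/B -(fineK Wf) muleC -lee_pdivlMr// => /le_trans; apply.
  by rewrite -!EFinM lee_fin mulrAC -powR_div ?(ltW U_gt0) ?(ltW UL0)// LE.
have WB : (mu W = mu B + mu (W `\` B))%E.
  have BW : W `&` B = B by apply: setIidr => x [].
  by rewrite (measureDI mu mmW mB) BW addeC.
have [|z [[Wz Bz] Nz gz]] := sublevel_point mmW Wy (measurableD mmW mB) (@subDsetl _ W B) Nn mg p0 GL0 (ltW G_gt0) Ig.
  rewrite LE//.
  have Df : mu (W `\` B) \is a fin_num.
    rewrite ge0_fin_numE//; apply: le_lt_trans Wy; apply: le_measure; rewrite ?inE//.
    exact: measurableD.
  have Bf : mu B \is a fin_num.
    by rewrite ge0_fin_numE//; apply: le_lt_trans Wy; apply: le_measure; rewrite ?inE// => x [].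
  move: muB WB; rewrite -(fineK Wf) -(fineK Bf) -(fineK Df) -!EFinM lee_fin lte_fin.
  move: W0'; set b := fine (mu B); set w := fine (mu (W `\` B)); set m := fine (mu W).
  move=> m0 bm; rewrite -EFinD => -[mE].
  have : L `^ (- p) * m < 2^-1 * m by rewrite ltr_pM2r.
  lra.
have uz : `|u z - 0| <= U * L.
  by rewrite subr0 leNgt; apply/negP => /ltW UL; apply: Bz.
have := est _ _ _ _ _ _ _ 0 (U * L) R00 G_gt0 Wg (conj Wz Nz) gz mu_ uz.
have -> : (fun x => u x - 0) = u by apply/funext => x; rewrite subr0.
move=> h; apply: (le_trans h); rewrite -!EFinM -!EFinD lee_fin.
have -> : C * (1 + L) * R0 * G0 + C * (1 + L) * U0 + e = C * (1 + L) * R0 * G + C * (1 + L) * U.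
  by rewrite /G /U /e'; field; rewrite !gt_eqF ?addr_gt0.
have : 0 <= C * U by rewrite mulr_ge0 ?ltW.
have : 0 <= C * L * R0 * G by rewrite !mulr_ge0 ?ltW.
lra.
Qed.

End SobolevFromLowerBound.

(** * Hoelder estimates from the lower bound *)

Section HolderExtension.
Context {R : realType} {X : metricType R}.

(** By homogeneity: a fraction [t] in []0, 1]] satisfies [t <= t ^ alpha]; apply this to
    [a / (a + b)] and [b / (a + b)], whose sum is 1. *)
Lemma powR_subadd (a b alpha : R) : 0 <= a -> 0 <= b -> alpha <= 1 ->
  (a + b) `^ alpha <= a `^ alpha + b `^ alpha.
Proof.
move=> a0 b0 al1.
have [->|an0] := eqVneq a 0; first by rewrite add0r lerDr powR_ge0.
have [->|bn0] := eqVneq b 0; first by rewrite addr0 lerDl powR_ge0.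
have agt0 : 0 < a by rewrite lt_neqAle eq_sym an0.
have bgt0 : 0 < b by rewrite lt_neqAle eq_sym bn0.
have ab0 : 0 < a + b by rewrite addr_gt0.
have frac c : 0 < c -> c <= a + b -> c / (a + b) * (a + b) `^ alpha <= c `^ alpha.
  move=> c0 cab.
  rewrite -ler_pdivlMr ?powR_gt0// -powR_div ?(ltW c0) ?(ltW ab0)//.
  by rewrite ger1_powR// divr_gt0//= ler_pdivrMr// mul1r.
have -> : (a + b) `^ alpha = a / (a + b) * (a + b) `^ alpha + b / (a + b) * (a + b) `^ alpha.
  by rewrite -mulrDl -mulrDl mulfV ?mul1r// gt_eqF.
by apply: lerD; apply: frac => //; lra.
Qed.

(* McShane: [v x = inf_(a in A) (u a + H * mdist x a ^ alpha)]. *)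
Lemma holder_extension (A : set X) (u : X -> R) (H alpha : R) :
  0 <= H -> 0 < alpha <= 1 ->
  (forall x y, A x -> A y -> `|u x - u y| <= H * mdist x y `^ alpha) ->
  exists v : X -> R, (forall x, A x -> v x = u x) /\
    forall x y, `|v x - v y| <= H * mdist x y `^ alpha.
Proof.
move=> H0 /andP[al0 al1] uA.
have [[a0 Aa0]|/forallNP A0] := pselect (exists a, A a); last first.
  exists (fun=> 0); split=> [x /A0//|x y].
  by rewrite subrr normr0 mulr_ge0// powR_ge0.
have tri (x y z : X) : H * mdist x z `^ alpha <= H * mdist x y `^ alpha + H * mdist y z `^ alpha.
  rewrite -mulrDr ler_wpM2l//.
  apply: (le_trans _ (powR_subadd (mdist_ge0 _ _) (mdist_ge0 _ _) al1)).
  by apply: ge0_ler_powR; rewrite ?nnegrE ?addr_ge0 ?mdist_ge0 ?(ltW al0)//; exact: metric_triangle.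
pose S (x : X) := [set u a + H * mdist x a `^ alpha | a in A].
have S0 (x : X) : S x !=set0 by exists (u a0 + H * mdist x a0 `^ alpha); exists a0.
have Slb (x b : X) : A b -> lbound (S x) (u b - H * mdist x b `^ alpha).
  move=> Ab _ [a Aa <-].
  have := uA _ _ Ab Aa; rewrite ler_norml => /andP[_].
  have := tri b x a; rewrite (metric_sym b x); lra.
have Sinf (x : X) : has_inf (S x) by split=> //; exists (u a0 - H * mdist x a0 `^ alpha); exact: Slb.
have le_inf (x y : X) : inf (S x) <= inf (S y) + H * mdist x y `^ alpha.
  rewrite -lerBlDr; apply: lb_le_inf => // _ [a Aa <-]; rewrite lerBlDr.
  apply: (@le_trans _ _ (u a + H * mdist x a `^ alpha)).
    by apply: ge_inf; [case: (Sinf x)|exists a].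
  by have := tri x y a; lra.
exists (fun x => inf (S x)); split=> [x Ax|x y]; last first.
  rewrite ler_norml; apply/andP; split.
    by have := le_inf y x; rewrite (metric_sym y x); lra.
  by have := le_inf x y; lra.
have xx : H * mdist x x `^ alpha = 0 by rewrite mdistxx powR0 ?gt_eqF// mulr0.
apply/eqP; rewrite eq_le; apply/andP; split.
  by apply: ge_inf; [case: (Sinf x)|exists x => //; rewrite xx addr0].
by apply: lb_le_inf => // y /(Slb x x Ax); rewrite xx subr0.
Qed.

End HolderExtension.

Section HolderFromLowerBound.
Context {R : realType} {d : measure_display} {X : borelMetricType R d}.
Variable mu : {measure set X -> \bar R}.
Hypothesis hX : metric_measure_space mu.
Implicit Types (x y z : X) (A B W N : set X) (u g v : X -> R).

Lemma hajlasz_gradientS A B p u g : measurable A -> measurable B -> B `<=` A ->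
  hajlasz_gradient mu A p u g -> hajlasz_gradient mu B p u g.
Proof.
move=> mA mB BA [g0 [mg Ig] [N [NA Nn ug]]]; split.
- by move=> x /BA; exact: g0.
- split; first exact: measurable_funS mg.
  apply: le_lt_trans Ig; apply: ge0_subset_integral => //.
  exact: measurable_powR_norm.
- exists (N `&` B); split=> [x []//| |x y [Bx Nx] [By Ny]].
    by apply: negligibleS Nn => x [].
  by apply: ug; split; [exact: BA|move=> ?; exact: Nx|exact: BA|move=> ?; exact: Ny].
Qed.

(** Shrinking the domain raises the mean of [g] by at most the [p]-th root of the mass ratio, and
    [N] stays the same. *)
Lemma grad_boundS A B p u g N G D : 0 < p -> 0 <= G -> 0 <= D ->
  measurable A -> measurable B -> B `<=` A -> (mu A <= D%:E * mu B)%E ->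
  grad_bound mu A p G u g N -> grad_bound mu B p (G * D `^ p^-1) u g N.
Proof.
move=> p0 G0 D0 mA mB BA AB [mg g0 Ig Nn ug]; split=> //.
- exact: measurable_funS mg.
- by move=> x /BA; exact: g0.
- apply: (@le_trans _ _ (\int[mu]_(x in A) (`|g x| `^ p)%:E)%E).
    apply: ge0_subset_integral => //.
    exact: measurable_powR_norm.
  apply: (le_trans Ig); rewrite powRM ?powR_ge0// -powRrM mulVf ?gt_eqF// powRr1//.
  by rewrite EFinM -muleA lee_wpmul2l// lee_fin powR_ge0.
- by move=> x y [/BA Bx Nx] [/BA By Ny]; exact: ug.
Qed.

Variables (sigma s kappa p : R).
Hypotheses (hsigma : 1 < sigma) (hs : 0 < s) (hkappa : 0 < kappa) (sp : s < p).
Hypothesis lower : measure_lower_bound mu s kappa.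

Let sigma0 : 0 < sigma. Proof. by apply: lt_trans hsigma. Qed.
Let p0 : 0 < p. Proof. exact: lt_trans sp. Qed.
Let alpha := 1 - s / p.
Let sp1 : s / p < 1. Proof. by rewrite ltr_pdivrMr// mul1r. Qed.
Let alpha0 : 0 < alpha. Proof. by rewrite subr_gt0. Qed.
Let alpha1 : alpha <= 1. Proof. by rewrite lerBlDr lerDl divr_ge0// ltW. Qed.

(** If [mdist x y] is comparable to [R0], the oscillation bound on [B0] is enough. Otherwise it is
    applied on the ball of radius [r = 2 * mdist x y] around [x]: the mean of [g] grows at most by a
    multiple of [(R0 / r) ^ (s / p)], which turns the factor [r] into
    [r ^ (1 - s / p) * R0 ^ (s / p)]. *)
Lemma holder_pairs : exists2 C : R, 0 < C &
  forall x0 R0 u g N G x y, 0 < R0 -> 0 < G ->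
    grad_bound mu (ball x0 (sigma * R0)) p G u g N ->
    (ball x0 R0 `\` N) x -> (ball x0 R0 `\` N) y ->
    `|u x - u y| <= C * mdist x y `^ alpha * R0 `^ (s / p) * G.
Proof.
have [C C0 osc] := osc_le hX hsigma hs p0 hkappa lower sp.
(* Below the threshold [a * R0], the [sigma]-dilate of the ball around [x] fits into that of
   [B0]. *)
pose a := (sigma - 1) / (2 * sigma).
have a0 : 0 < a by rewrite divr_gt0 ?subr_gt0 ?mulr_gt0.
pose c1 := 2 * kappa^-1 `^ p^-1 * (2^-1) `^ (s / p).
have c10 : 0 < c1 by rewrite !mulr_gt0// powR_gt0 ?invr_gt0.
have c20 : 0 < a^-1 `^ alpha by rewrite powR_gt0// invr_gt0.
exists (C * (c1 + a^-1 `^ alpha)); first by rewrite mulr_gt0// addr_gt0.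
move=> x0 R0 u g N G x y R00 G0 Wg Bx By.
have [->|xy] := eqVneq x y.
  by rewrite subrr normr0 !mulr_ge0 ?powR_ge0// ?ltW// addr_gt0.
have d0 : 0 < mdist x y by rewrite mdist_gt0.
have da0 : 0 < mdist x y `^ alpha by exact: powR_gt0.
have Rs0 : 0 < R0 `^ (s / p) by exact: powR_gt0.
have dx : mdist x0 x < R0 by apply/in_ballP; case: Bx.
have [far|near] := leP (a * R0) (mdist x y).
  apply: (le_trans (osc _ _ _ _ _ _ _ _ R00 G0 Wg Bx By)).
  rewrite ler_pM2r//.
  have -> : C * R0 = C * (R0 `^ alpha * R0 `^ (s / p)).
    by rewrite -powRD ?subrK ?powRr1 ?(ltW R00)// gt_eqF// implybT.
  rewrite mulrA -!mulrA ler_pM2l// mulrA ler_pM2r//.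
  apply: (@le_trans _ _ (a^-1 `^ alpha * mdist x y `^ alpha)).
    rewrite -powRM ?invr_ge0 ?(ltW a0) ?(ltW d0)//.
    apply: ge0_ler_powR; rewrite ?nnegrE ?mulr_ge0 ?invr_ge0 ?(ltW a0) ?(ltW d0) ?(ltW R00) ?(ltW alpha0)//.
    by rewrite mulrC ler_pdivlMr// mulrC.
  by rewrite ler_pM2r// lerDr ltW.
pose r := 2 * mdist x y.
have r0 : 0 < r by rewrite mulr_gt0.
have sr0 : 0 < sigma * r by rewrite mulr_gt0.
have sR0 : 0 < sigma * R0 by rewrite mulr_gt0.
have srR : sigma * r <= (sigma - 1) * R0.
  have -> : (sigma - 1) * R0 = 2 * sigma * (a * R0) by rewrite /a; field; rewrite gt_eqF.
  have -> : sigma * r = 2 * sigma * mdist x y by rewrite /r; ring.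
  by rewrite ler_pM2l ?mulr_gt0// ltW.
have sub : ball x (sigma * r) `<=` ball x0 (sigma * R0) by apply: sub_ball; lra.
have rr : sigma * r <= sigma * R0 by lra.
have mass := lower_bound_mass hX hkappa lower sub sr0 rr.
have D0 : 0 <= kappa^-1 * (sigma * R0 / (sigma * r)) `^ s.
  by rewrite mulr_ge0 ?powR_ge0// invr_ge0 ltW.
have Bg := grad_boundS p0 (ltW G0) D0 (measurable_metric_ball _ _)
  (measurable_metric_ball _ _) sub mass Wg.
have Dp : (kappa^-1 * (sigma * R0 / (sigma * r)) `^ s) `^ p^-1 =
    kappa^-1 `^ p^-1 * 2^-1 `^ (s / p) * (R0 `^ (s / p) / mdist x y `^ (s / p)).
  have -> : sigma * R0 / (sigma * r) = 2^-1 * (R0 / mdist x y).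
    by rewrite /r; field; rewrite !gt_eqF.
  rewrite powRM ?powR_ge0 ?invr_ge0 ?(ltW hkappa)// -powRrM.
  by rewrite powRM ?invr_ge0 ?divr_ge0 ?(ltW R00) ?(ltW d0)// powR_div ?(ltW R00) ?(ltW d0)// mulrA.
have G'0 : 0 < G * (kappa^-1 * (sigma * R0 / (sigma * r)) `^ s) `^ p^-1.
  by rewrite mulr_gt0// powR_gt0// mulr_gt0 ?invr_gt0// powR_gt0// divr_gt0.
have Bx' : (ball x r `\` N) x by split; [exact: ball_self|case: Bx].
have By' : (ball x r `\` N) y.
  by split; [apply/in_ballP; rewrite /r; lra|case: By].
apply: (le_trans (osc _ _ _ _ _ _ _ _ r0 G'0 Bg Bx' By')).
have dE : mdist x y `^ alpha = mdist x y / mdist x y `^ (s / p).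
  by rewrite /alpha powRB ?powRr1 ?mdist_ge0// gt_eqF// implybT.
have ds0 : 0 < mdist x y `^ (s / p) by exact: powR_gt0.
rewrite Dp; apply: (@le_trans _ _ (C * c1 * mdist x y `^ alpha * R0 `^ (s / p) * G)).
  rewrite dE /r /c1 le_eqVlt; apply/orP; left; apply/eqP.
  move: (kappa^-1 `^ p^-1) (2^-1 `^ (s / p)) => k t.
  by field; rewrite gt_eqF.
by rewrite !ler_pM2r// ler_pM2l// lerDl ltW.
Qed.

(** The pairwise bound holds on [B0] outside the null set [N]; the Hoelder extension of [u] from
    there supplies values on [N]. *)
Lemma holder_representative : exists2 C : R, 0 < C &
  forall x0 R0 u g, 0 < R0 -> hajlasz_gradient mu (ball x0 (sigma * R0)) p u g ->
  exists v : X -> R, {ae mu, forall x, v x = u x} /\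
    forall x y, ball x0 R0 x -> ball x0 R0 y ->
      (`|v x - v y|%:E <= (C * mdist x y `^ (1 - s / p) * R0 `^ (s / p))%:E *
         pmean mu (ball x0 (sigma * R0)) p g)%E.
Proof.
have [C C0 pairs] := holder_pairs; exists C => //.
move=> x0 R0 u g R00 [g0 Lg [N [NW Nn ug]]].
have sR0 : 0 < sigma * R0 by rewrite mulr_gt0.
have mW := mu_ball hX x0 sR0.
have [G0 G00 gE] := pmean_Lp p0 mW Lg.
have uN x y : (ball x0 R0 `\` N) x -> (ball x0 R0 `\` N) y ->
    `|u x - u y| <= C * R0 `^ (s / p) * G0 * mdist x y `^ alpha.
  (* The pairwise bound needs a positive [G]: the mean is increased by [e / K], with [K] making the
     resulting error at most [e]. *)
  move=> Bx By; apply/ler_addgt0Pr => e e0.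
  pose K := C * mdist x y `^ alpha * R0 `^ (s / p) + 1.
  have K1 : 0 <= C * mdist x y `^ alpha * R0 `^ (s / p).
    by rewrite !mulr_ge0 ?powR_ge0// ltW.
  have K0 : 0 < K by rewrite ltr_wpDl.
  have eK : 0 < e / K by rewrite divr_gt0.
  have G1 : 0 < G0 + e / K by rewrite ltr_wpDl.
  have Wg : grad_bound mu (ball x0 (sigma * R0)) p (G0 + e / K) u g N.
    split=> //; first by case: Lg.
    by apply/(pmean_le _ p0 (ltW G1) mW); rewrite gE lee_fin lerDl ltW.
  apply: (le_trans (pairs _ _ _ _ _ _ _ _ R00 G1 Wg Bx By)).
  have : (C * mdist x y `^ alpha * R0 `^ (s / p)) * (e / K) <= e.
    by rewrite mulrA mulrAC -[leRHS]mul1r ler_wpM2r ?(ltW e0)// ler_pdivrMr// mul1r lerDl.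
  by rewrite mulrDr; lra.
have H0 : 0 <= C * R0 `^ (s / p) * G0 by rewrite !mulr_ge0 ?powR_ge0// ltW.
have [|v [vu vH]] := holder_extension H0 _ uN; first by rewrite alpha0.
(* The extension is used only inside the ball, since the representative must agree with [u] almost
   everywhere on [X]. *)
pose w x := if x \in (ball x0 R0 : set X) then v x else u x.
exists w; split=> [|x y Bx By].
  apply: negligibleS Nn => x /=; rewrite /w.
  case: ifPn => [|_]; last by case.
  rewrite inE => Bx vux; apply: contrapT => Nx; apply: vux; exact: vu.
rewrite /w !mem_set// gE -EFinM lee_fin.
by apply: (le_trans (vH _ _)); rewrite le_eqVlt; apply/orP; left; apply/eqP; rewrite /alpha; ring.
Qed.

End HolderFromLowerBound.

(** * The lower bound from the estimates *)

Section Iteration.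
Context {R : realType}.
Variables (s p K : R) (m : nat -> R).
Hypotheses (p0 : 0 < p) (ps : p < s) (K0 : 0 < K).

(* The bound [ln (m j) <= ln D - j * s * ln 2], where [D] is the left-hand side,
   is preserved by the recursion, so it cannot hold at [j = 0]. *)
Lemma iteration_lower_bound (e : R) : 0 < e -> (forall j, e <= m j) ->
  (forall j, m j.+1 `^ (sobolev_exponent s p)^-1 <= K * 2 ^+ j * m j `^ p^-1) ->
  2 `^ (- (s * (s - p) / p)) * K `^ (- s) <= m 0%N.
Proof.
move=> e0 em rec.
have s0 : 0 < s by apply: lt_trans ps.
have sp0 : 0 < s - p by rewrite subr_gt0.
have [q qE] : exists q, q = sobolev_exponent s p by eexists.
have q0 : 0 < q by rewrite qE divr_gt0// mulr_gt0.
have m0 j : 0 < m j by apply: lt_le_trans (em j).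
have two0 : 0 < 2 :> R by [].
have ln2 : 0 < ln 2 :> R by rewrite ln_gt0//; lra.
pose D := - (s * (s - p) / p) * ln 2 - s * ln K.
rewrite -ler_ln ?posrE ?mulr_gt0 ?powR_gt0// lnM ?posrE ?powR_gt0// !ln_powR mulNr [- s * _]mulNr.
rewrite -mulNr -/D leNgt; apply/negP => mD.
have lnrec j : ln (m j.+1) <= q * (ln K + j%:R * ln 2 + p^-1 * ln (m j)).
  have : ln (m j.+1 `^ q^-1) <= ln (K * 2 ^+ j * m j `^ p^-1).
    rewrite ler_ln ?posrE ?mulr_gt0 ?powR_gt0 ?exprn_gt0//.
    by rewrite qE; exact: rec.
  rewrite !lnM ?posrE ?mulr_gt0 ?powR_gt0 ?exprn_gt0// !ln_powR lnXn//.
  by rewrite mulr_natl ler_pdivrMl.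
have mj j : ln (m j) <= D - j%:R * s * ln 2.
  elim: j => [|j IHj]; first by rewrite !mul0r subr0 ltW.
  apply: (le_trans (lnrec j)).
  apply: (@le_trans _ _ (q * (ln K + j%:R * ln 2 + p^-1 * (D - j%:R * s * ln 2)))).
    by rewrite ler_pM2l// lerD2l ler_pM2l// invr_gt0.
  (* An equality: [q * (1 - s / p) = - s] matches the slopes in [j], and [D] is the constant term
     then forced by the recursion. *)
  rewrite le_eqVlt; apply/orP; left; apply/eqP.
  rewrite qE /sobolev_exponent /D -natr1; field.
  by rewrite !gt_eqF.
have sl0 : 0 < s * ln 2 by rewrite mulr_gt0.
(* At this [n] the bound [D - n * s * ln 2] has dropped below [ln e]. *)
pose n := Num.bound `|(D - ln e) / (s * ln 2)|.
have : `|(D - ln e) / (s * ln 2)| < n%:R by exact: archi_boundP.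
move=> /(le_lt_trans (ler_norm _)); rewrite ltr_pdivrMr// mulrA.
have : ln e <= ln (m n) by rewrite ler_ln ?posrE.
have := mj n; lra.
Qed.

End Iteration.

(** * Cutoff functions and their means *)

Section TestFunctions.
Context {R : realType} {d : measure_display} {X : borelMetricType R d}.
Variable mu : {measure set X -> \bar R}.
Hypothesis hX : metric_measure_space mu.
Implicit Types (x y z : X) (A B W N : set X) (u g v : X -> R).

Lemma ae_ball (P : X -> Prop) x r : {ae mu, forall x, P x} -> 0 < r ->
  exists y, ball x r y /\ P y.
Proof.
move=> [N [mN N0 PN]] r0; apply: contrapT => /forallNP nP.
have /andP[B0 _] := mu_ball hX x r0.
suff : (mu (ball x r) <= mu N)%E by rewrite N0 leNgt B0.
apply: le_measure; rewrite ?inE//; first exact: measurable_metric_ball.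
move=> y xy; apply: PN => /= Py; exact: (nP y).
Qed.

Lemma integral_powR_le_supp A W p h u : measurable A -> measurable W ->
  measurable_fun W u -> 0 < p -> 0 <= h -> (forall x, A x -> `|u x| <= h) ->
  (forall x, ~ A x -> u x = 0) ->
  (\int[mu]_(x in W) (`|u x| `^ p)%:E <= (h `^ p)%:E * mu A)%E.
Proof.
move=> mA mW mu_ p0 h0 uh u0.
apply: (@le_trans _ _ (\int[mu]_(x in W) ((h `^ p)%:E * (\1_A x)%:E))%E).
  apply: ge0_le_integral => //.
  - exact: measurable_powR_norm.
  - by apply: measurable_funeM; apply/measurable_EFinP; exact: measurable_indic.
  - move=> x _; rewrite -EFinM lee_fin indicE.
    have [/set_mem Ax|/negP nAx] := boolP (x \in A).
      by rewrite mulr1 ge0_ler_powR ?nnegrE ?(ltW p0)//; exact: uh.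
    by rewrite u0 ?normr0 ?powR0 ?mulr0 ?gt_eqF// => /mem_set.
rewrite ge0_integralZl_EFin//; last 2 first.
- by apply/measurable_EFinP; exact: measurable_indic.
- exact: powR_ge0.
rewrite integral_indic//; apply: lee_wpmul2l; first by rewrite lee_fin powR_ge0.
by apply: le_measure; rewrite ?inE//; exact: measurableI.
Qed.

(* The junk value is [0] if [A] or [W] has infinite mass. *)
Definition mass_ratio A W : R := fine (mu A) / fine (mu W).

Lemma pmean_le_supp A W p h u : measurable A -> measurable W ->
  (mu A < +oo)%E -> (0 < mu W < +oo)%E ->
  measurable_fun W u -> 0 < p -> 0 <= h -> (forall x, A x -> `|u x| <= h) ->
  (forall x, ~ A x -> u x = 0) ->
  (pmean mu W p u <= (h * mass_ratio A W `^ p^-1)%:E)%E.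
Proof.
move=> mA mW Afin muW mu_ p0 h0 uh u0.
case/andP: (muW) => W0 Wy.
have Wf : mu W \is a fin_num by rewrite ge0_fin_numE.
have Af : mu A \is a fin_num by rewrite ge0_fin_numE.
have W0' : 0 < fine (mu W) by rewrite fine_gt0// W0.
have r0 : 0 <= mass_ratio A W by rewrite divr_ge0// fine_ge0.
apply/pmean_le => //; first by rewrite mulr_ge0// powR_ge0.
apply: (le_trans (integral_powR_le_supp mA mW mu_ p0 h0 uh u0)).
rewrite powRM ?powR_ge0// -powRrM mulVf ?gt_eqF// powRr1//.
by rewrite -(fineK Wf) -(fineK Af) -!EFinM lee_fin /mass_ratio mulrA mulfVK ?gt_eqF.
Qed.

(** Dividing by the larger mass of [W] only lowers the bound. It makes the estimates on [B] and on
    its dilate [W] comparable through ratios with one denominator, as a recursion requires. *)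
Lemma pmean_ge_supp A B W p h u : measurable A -> measurable B -> A `<=` B ->
  (0 < mu B < +oo)%E -> (mu B <= mu W < +oo)%E ->
  measurable_fun B u -> 0 < p -> 0 <= h -> (forall x, A x -> h <= `|u x|) ->
  ((h * mass_ratio A W `^ p^-1)%:E <= pmean mu B p u)%E.
Proof.
move=> mA mB AB muB /andP[BW Wy] mu_ p0 h0 uh.
case/andP: (muB) => B0 By.
have [->|/eqP py] := pselect (pmean mu B p u = +oo%E); first exact: leey.
have pf : pmean mu B p u \is a fin_num by rewrite ge0_fin_numE ?pmean_ge0// ltey.
have P0 : 0 <= fine (pmean mu B p u) by rewrite fine_ge0// pmean_ge0.
move: P0 (fineK pf); move: (fine _) => P P0 pE; rewrite -pE lee_fin.
have IP : (\int[mu]_(x in B) (`|u x| `^ p)%:E <= (P `^ p)%:E * mu B)%E.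
  by apply/pmean_le => //; rewrite pE.
have W0 : (0 < mu W)%E by apply: lt_le_trans BW.
have Bf : mu B \is a fin_num by rewrite ge0_fin_numE.
have Wf : mu W \is a fin_num by rewrite ge0_fin_numE.
have Af : mu A \is a fin_num.
  by rewrite ge0_fin_numE//; apply: le_lt_trans By; apply: le_measure; rewrite ?inE.
have W0' : 0 < fine (mu W) by rewrite fine_gt0// W0.
have r0 : 0 <= mass_ratio A W by rewrite divr_ge0// fine_ge0.
have hA : ((h `^ p)%:E * mu A <= (P `^ p)%:E * mu B)%E.
  apply: le_trans IP; rewrite -(integral_cst mu mA (h `^ p)%:E).
  apply: (@le_trans _ _ (\int[mu]_(x in A) (`|u x| `^ p)%:E)%E).
    apply: ge0_le_integral => //.
    - by move=> x _; rewrite lee_fin powR_ge0.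
    - by apply: measurable_powR_norm; exact: measurable_funS mu_.
    - move=> x Ax; rewrite lee_fin ge0_ler_powR ?nnegrE ?(ltW p0)//; exact: uh.
  apply: ge0_subset_integral => //.
  exact: measurable_powR_norm.
have : h `^ p * mass_ratio A W <= P `^ p.
  rewrite /mass_ratio mulrA ler_pdivrMr// -lee_fin !EFinM (fineK Wf) (fineK Af).
  by apply: (le_trans hA); rewrite lee_wpmul2l// lee_fin powR_ge0.
have p10 : 0 <= p^-1 by rewrite invr_ge0 ltW.
move=> /(ge0_ler_powR p10); rewrite !nnegrE => /(_ (mulr_ge0 (powR_ge0 _ _) r0) (powR_ge0 _ _)).
by rewrite powRM ?powR_ge0// -!powRrM mulfV ?gt_eqF// !powRr1.
Qed.

Lemma cutoff x r1 r2 : r1 < r2 -> exists u : X -> R,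
  [/\ measurable_fun [set: X] u, forall y, 0 <= u y <= 1,
      forall y, ball x r1 y -> u y = 1, forall y, ~ ball x r2 y -> u y = 0 &
      forall y z, `|u y - u z| <= mdist y z / (r2 - r1)].
Proof.
move=> r12; have r0 : 0 < r2 - r1 by rewrite subr_gt0.
pose f y : R := (r2 - mdist x y) / (r2 - r1).
exists (fun y => Num.max 0 (Num.min 1 (f y))); split.
- apply: measurable_maxr => //; apply: measurable_minr => //.
  apply: measurable_funM => //; apply: measurable_funB => //.
  exact: measurable_mdist.
- by move=> y; rewrite le_max lexx ge_max ler01 ge_min lexx.
- move=> y /in_ballP xy.
  have : 1 <= f y by rewrite ler_pdivlMr//; lra.
  by move=> /min_idPl ->; apply/max_idPr.
- move=> y xy; have /negP : ~ (mdist x y < r2) by move=> /in_ballP.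
  rewrite -leNgt => r2y.
  have fy : f y <= 0 by rewrite ler_pdivrMr// mul0r subr_le0.
  by apply/max_idPl; rewrite ge_min fy orbT.
- move=> y z.
  have : `|f y - f z| <= mdist y z / (r2 - r1).
    rewrite -mulrBl normrM (gtr0_norm (x := (r2 - r1)^-1)) ?invr_gt0//.
    rewrite ler_pM2r ?invr_gt0//.
    have := metric_triangle x y z; have := metric_triangle x z y.
    rewrite (metric_sym z y) => h1 h2; rewrite ler_norml; lra.
  apply: le_trans; move: (f y) (f z) => a b.
  (* Truncation to [[0, 1]] is 1-Lipschitz; this one-sided form is applied in both directions. *)
  have clamp (a' b' t : R) : 0 <= t -> a' <= b' + t ->
      Num.max 0 (Num.min 1 a') <= Num.max 0 (Num.min 1 b') + t.
    move=> t0 abt; rewrite ge_max addr_ge0 ?le_max ?lexx//=.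
    apply: (@le_trans _ _ (Num.min 1 b' + t)); last by rewrite lerD2r le_max lexx orbT.
    by have [b1|b1] := leP 1 b'; rewrite ge_min; apply/orP; [left; lra|right].
  have h1 := ler_norm (a - b); have h2 := ler_norm (b - a); rewrite distrC in h2.
  rewrite ler_norml; apply/andP; split.
    by rewrite lerNl opprB lerBlDl; apply: clamp => //; lra.
  by rewrite lerBlDl; apply: clamp => //; lra.
Qed.

End TestFunctions.

(** * Iteration on concentric balls *)

Section LowerBoundFromSobolev.
Context {R : realType} {d : measure_display} {X : borelMetricType R d}.
Variable mu : {measure set X -> \bar R}.
Hypothesis hX : metric_measure_space mu.
Implicit Types (x y z : X) (A B W N : set X) (u g v : X -> R).

(** The gradient is the Lipschitz constant on the outer ball and 0 elsewhere: a pair with a point in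
    that ball sees the full constant, and on any other pair [u] vanishes. A single pair [u], [g]
    serves all [W] and [p]. *)
Lemma cutoff_M1p x r1 r2 : 0 < r2 -> r1 < r2 -> exists u g : X -> R,
  [/\ measurable_fun [set: X] u,
      forall y, ball x r1 y -> u y = 1, forall y, ~ ball x r2 y -> u y = 0,
      forall W p, measurable W -> 0 < p ->
        M1p mu W p u /\ hajlasz_gradient mu W p u g &
      forall W p, measurable W -> (0 < mu W < +oo)%E -> 0 < p ->
        (pmean mu W p u <= (mass_ratio mu (ball x r2) W `^ p^-1)%:E)%E /\
        (pmean mu W p g <= ((r2 - r1)^-1 * mass_ratio mu (ball x r2) W `^ p^-1)%:E)%E].
Proof.
move=> r20 r12; have [u [mu_ u01 u1 u0 uL]] := cutoff x r12.
have mb : measurable (ball x r2) := measurable_metric_ball _ _.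
have L0 : 0 <= (r2 - r1)^-1 by rewrite invr_ge0 subr_ge0 ltW.
pose g y : R := (r2 - r1)^-1 * \1_(ball x r2) y.
have mg : measurable_fun [set: X] g.
  by apply: measurable_funM => //; exact: measurable_indic.
have gE y : ball x r2 y -> g y = (r2 - r1)^-1.
  by move=> xy; rewrite /g indicE mem_set// mulr1.
have g0 y : ~ ball x r2 y -> g y = 0.
  by move=> xy; rewrite /g indicE memNset// mulr0.
have g_ge0 y : 0 <= g y by rewrite mulr_ge0.
have uh y : ball x r2 y -> `|u y| <= 1.
  by move=> _; have /andP[? ?] := u01 y; rewrite ger0_norm.
have gh y : ball x r2 y -> `|g y| <= (r2 - r1)^-1 by move=> /gE ->; rewrite ger0_norm.
have /andP[_ bfin] := mu_ball hX x r20.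
have mS W (f : X -> R) : measurable_fun [set: X] f -> measurable_fun W f.
  by apply: measurable_funS.
have finite_supp W (p h : R) (f : X -> R) : measurable W -> measurable_fun [set: X] f -> 0 < p -> 0 <= h ->
    (forall y, ball x r2 y -> `|f y| <= h) -> (forall y, ~ ball x r2 y -> f y = 0) ->
    Lp_on mu W p f.
  move=> mW mf p0 h0 fh f0; split; first exact: mS.
  apply: le_lt_trans (integral_powR_le_supp mu mb mW (mS _ _ mf) p0 h0 fh f0) _.
  by rewrite lte_mul_pinfty// lee_fin powR_ge0.
exists u, g; split=> //.
- move=> W p mW p0.
  have hg : hajlasz_gradient mu W p u g.
    split=> //; first exact: (finite_supp _ _ (r2 - r1)^-1).
    exists set0; split=> //; first exact: negligible_set0.
    move=> y z _ _.
    have [by_|nby] := pselect (ball x r2 y).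
      by apply: (le_trans (uL y z)); rewrite ler_wpM2l ?mdist_ge0// gE// lerDl.
    have [bz|nbz] := pselect (ball x r2 z).
      by apply: (le_trans (uL y z)); rewrite ler_wpM2l ?mdist_ge0// (gE z)// lerDr.
    by rewrite !u0// subrr normr0 mulr_ge0 ?mdist_ge0// addr_ge0.
  by split=> //; split; [exact: (finite_supp _ _ 1)|exists g].
- move=> W p mW Wfin p0; split.
    rewrite -[leRHS]mul1e -EFinM.
    exact: (pmean_le_supp mb mW bfin Wfin (mS _ _ mu_) p0 ler01 uh u0).
  exact: (pmean_le_supp mb mW bfin Wfin (mS _ _ mg) p0 L0 gh g0).
Qed.

Lemma mass_ratio_le A A' W : measurable A -> measurable A' -> A `<=` A' ->
  (mu A' < +oo)%E -> mass_ratio mu A W <= mass_ratio mu A' W.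
Proof.
move=> mA mA' AA' fin; rewrite ler_wpM2r ?invr_ge0 ?fine_ge0//.
have le : (mu A <= mu A')%E by apply: le_measure; rewrite ?inE.
rewrite fine_le ?ge0_fin_numE//; exact: le_lt_trans fin.
Qed.

Lemma mass_ratio_mu A W : (mu A < +oo)%E -> (0 < mu W < +oo)%E ->
  (mu A / mu W)%E = (mass_ratio mu A W)%:E.
Proof.
move=> Afin /andP[W0 Wy].
have Wf : mu W \is a fin_num by rewrite ge0_fin_numE// ltW.
have Af : mu A \is a fin_num by rewrite ge0_fin_numE.
by rewrite -(fineK Wf) -(fineK Af) inver gt_eqF ?fine_gt0 ?W0// -EFinM.
Qed.

(** The radii decrease from [r], at [j = 0], towards [r / 2], with gaps [r / (4 * 2 ^ j)]. The gaps
    produce the factor [2 ^ j] of the recursion. *)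
Definition shrinking_radius (r : R) (j : nat) : R := r * (2^-1 + 2^-1 ^+ j.+1).

Lemma shrinking_radius0 r : shrinking_radius r 0 = r.
Proof. by rewrite /shrinking_radius expr1; field. Qed.

Lemma shrinking_radius_step r j : 0 < r ->
  (shrinking_radius r j - shrinking_radius r j.+1)^-1 = 4 * 2 ^+ j / r.
Proof.
move=> r0; have t0 : 2 ^+ j != 0 :> R by rewrite gt_eqF// exprn_gt0.
have -> : shrinking_radius r j - shrinking_radius r j.+1 = r / (4 * 2 ^+ j).
  by rewrite /shrinking_radius !exprS !exprVn; field.
by field; rewrite t0 gt_eqF.
Qed.

Lemma shrinking_radius_gt r j : 0 < r -> r / 2 < shrinking_radius r j.
Proof. by move=> r0; rewrite ltr_pM2l// ltrDl exprn_gt0. Qed.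

Lemma shrinking_radius_lt r j : 0 < r ->
  shrinking_radius r j.+1 < shrinking_radius r j.
Proof.
move=> r0; rewrite ltr_pM2l// ltrD2l exprS gtr_pMl ?exprn_gt0//.
by rewrite invf_lt1//; lra.
Qed.

Lemma shrinking_radius_le r j : 0 < r -> shrinking_radius r j <= r.
Proof.
move=> r0; elim: j => [|j]; first by rewrite shrinking_radius0.
by apply: le_trans; rewrite ltW// shrinking_radius_lt.
Qed.

Variables (sigma s p C : R).
Hypotheses (hsigma : 1 < sigma) (hp : 0 < p) (hps : p < s) (hC : 0 < C).

Let sigma0 : 0 < sigma. Proof. by apply: lt_trans hsigma. Qed.
Let s0 : 0 < s. Proof. by apply: lt_trans hps. Qed.

Lemma mass_ratio_iteration x r W : 0 < r -> (0 < mu W < +oo)%E -> forall K, 0 < K ->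
  (forall j, mass_ratio mu (ball x (shrinking_radius r j.+1)) W `^ (sobolev_exponent s p)^-1 <=
     K * 2 ^+ j * mass_ratio mu (ball x (shrinking_radius r j)) W `^ p^-1) ->
  2 `^ (- (s * (s - p) / p)) * K `^ (- s) <= mass_ratio mu (ball x r) W.
Proof.
move=> r0 muW K K0 rec; rewrite -[in leRHS](shrinking_radius0 r).
case/andP: (muW) => W0 Wy.
have r20 : 0 < r / 2 by rewrite divr_gt0.
(* All radii exceed [r / 2], so the ball of that radius provides the positive floor [e]. *)
apply: (iteration_lower_bound (m := fun j => mass_ratio mu (ball x (shrinking_radius r j)) W)
  hp hps K0 (e := mass_ratio mu (ball x (r / 2)) W)) => //.
  by rewrite divr_gt0// fine_gt0// ?W0// mu_ball.
move=> j; have rj := shrinking_radius_gt j r0.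
apply: mass_ratio_le; try exact: measurable_metric_ball.
  by apply: sub_ball; rewrite mdistxx add0r ltW.
by have /andP[] := mu_ball hX x (lt_trans r20 rj).
Qed.

(** The iteration with [K = c * (r' / r)] yields the factor [K ^ (- s)], which contains
    [(r / r') ^ s]. Replacing the dilate of [ball y r'] by the ball itself in the denominator only
    increases the ratio. *)
Lemma lower_bound_of_recursion c x y r r' : 0 < c -> ball x r `<=` ball y r' -> 0 < r -> r <= r' ->
  (forall j, mass_ratio mu (ball x (shrinking_radius r j.+1)) (ball y (sigma * r'))
      `^ (sobolev_exponent s p)^-1 <=
     c * (r' / r) * 2 ^+ j *
     mass_ratio mu (ball x (shrinking_radius r j)) (ball y (sigma * r')) `^ p^-1) ->
  ((2 `^ (- (s * (s - p) / p)) * c `^ (- s) * (r / r') `^ s)%:E <=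
    mu (ball x r) / mu (ball y r'))%E.
Proof.
move=> c0 sub r0 rr' rec.
have r'0 : 0 < r' by apply: lt_le_trans rr'.
have sr'0 : 0 < sigma * r' by rewrite mulr_gt0.
have /andP[_ xfin] := mu_ball hX x r0.
have muB := mu_ball hX y r'0; case/andP: (muB) => B0 By.
have muW := mu_ball hX y sr'0; case/andP: (muW) => W0 Wy.
have K0 : 0 < c * (r' / r) by rewrite mulr_gt0// divr_gt0.
have := mass_ratio_iteration r0 muW K0 rec.
rewrite powRM ?divr_ge0 ?(ltW c0) ?(ltW r0) ?(ltW r'0)// mulrA.
have -> : (r' / r) `^ (- s) = (r / r') `^ s.
  by rewrite powRN -powR_inv ?invf_div// divr_ge0 ?ltW.
rewrite mass_ratio_mu// lee_fin => /le_trans; apply.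
rewrite ler_wpM2l ?fine_ge0// lef_pV2 ?posrE ?fine_gt0 ?W0 ?B0//.
have le : (mu (ball y r') <= mu (ball y (sigma * r')))%E.
  apply: le_measure; rewrite ?inE; try exact: measurable_metric_ball.
  by apply: sub_ball; rewrite mdistxx add0r ler_peMl// ltW.
by rewrite fine_le// ge0_fin_numE.
Qed.

(** The estimate on [ball y r'] is tested on the cutoff between consecutive radii: the left side
    sees the inner ball, where [u = 1], and the right side only the outer one. *)
Lemma lower_bound_of_sobolev : sobolev_estimate mu sigma s p C ->
  exists kappa, 0 < kappa /\ measure_lower_bound mu s kappa.
Proof.
move=> est; exists (2 `^ (- (s * (s - p) / p)) * (5 * C) `^ (- s)); split.
  by rewrite mulr_gt0// powR_gt0// mulr_gt0.
move=> x y r r' sub r0 rr'.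
apply: lower_bound_of_recursion => //; first by rewrite mulr_gt0.
move=> j.
have r'0 : 0 < r' by apply: lt_le_trans rr'.
have sr'0 : 0 < sigma * r' by rewrite mulr_gt0.
have muW := mu_ball hX y sr'0; case/andP: (muW) => W0 Wy.
have mW : measurable (ball y (sigma * r')) := measurable_metric_ball _ _.
have rj0 : 0 < shrinking_radius r j by apply: lt_trans (shrinking_radius_gt j r0); rewrite divr_gt0.
have [u [g [mu_ u1 u0 uM um]]] := cutoff_M1p x rj0 (shrinking_radius_lt j r0).
have [Mu Dg] := uM _ p mW hp.
have [pu pg] := um _ p mW muW hp.
have sub1 : ball x (shrinking_radius r j.+1) `<=` ball y r'.
  apply: subset_trans sub; apply: sub_ball; rewrite mdistxx add0r; exact: shrinking_radius_le.
have q0 : 0 < sobolev_exponent s p by rewrite divr_gt0 ?mulr_gt0 ?subr_gt0.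
have BW : (mu (ball y r') <= mu (ball y (sigma * r')) < +oo)%E.
  rewrite Wy andbT; apply: le_measure; rewrite ?inE; try exact: measurable_metric_ball.
  by apply: sub_ball; rewrite mdistxx add0r ler_peMl// ltW.
have low := @pmean_ge_supp _ _ _ mu (ball x (shrinking_radius r j.+1)) (ball y r')
  (ball y (sigma * r')) (sobolev_exponent s p) 1 u (measurable_metric_ball _ _)
  (measurable_metric_ball _ _) sub1 (mu_ball hX y r'0) BW _ q0 ler01 _.
have := est y r' r'0 u g Mu Dg.
have {}low := low (measurable_funS measurableT (@subsetT _ _) mu_) _.
move=> /(le_trans (low _)) => {low}.
rewrite mul1r => h.
set m := mass_ratio mu (ball x (shrinking_radius r j)) _ `^ _ in pu pg *.
have m0 : 0 <= m by exact: powR_ge0.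
rewrite -lee_fin; apply: (le_trans (h _)).
  by move=> z /u1 ->; rewrite normr1.
apply: (@le_trans _ _ ((C * r')%:E * (4 * 2 ^+ j / r * m)%:E + C%:E * m%:E)%E).
  rewrite -shrinking_radius_step//; apply: leeD; apply: lee_wpmul2l => //; rewrite lee_fin ltW//.
  by rewrite mulr_gt0.
rewrite -!EFinM -EFinD lee_fin.
(* As [(r' / r) * 2 ^ j >= 1], the term in [u] is absorbed into the gradient term: [4 + 1 = 5]. *)
have j1 : 1 <= 2 ^+ j :> R by rewrite exprn_ege1//; lra.
have rr1 : 1 <= r' / r by rewrite ler_pdivlMr// mul1r.
have -> : C * r' * (4 * 2 ^+ j / r * m) + C * m = (4 * (r' / r * 2 ^+ j) + 1) * (C * m) by field; rewrite gt_eqF.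
have -> : 5 * C * (r' / r) * 2 ^+ j * m = 5 * (r' / r * 2 ^+ j) * (C * m) by ring.
rewrite ler_wpM2r ?mulr_ge0 ?(ltW hC)//.
have : 1 <= r' / r * 2 ^+ j by rewrite mulr_ege1.
lra.
Qed.

(* If [ball x r] fills less than half of [ball y r'], then whichever [gamma] is
   subtracted, the cutoff stays at distance [1/2] from it either on the inner ball
   or on the complement of the outer one, which is at least as large. *)
Lemma lower_bound_of_sobolev_poincare : sobolev_poincare_estimate mu sigma s p C ->
  exists kappa, 0 < kappa /\ measure_lower_bound mu s kappa.
Proof.
(* [8 = 4 * 2]: 4 comes from the gaps of the radii and 2 from the height [1 / 2]. *)
move=> est; pose c := 2 `^ (- (s * (s - p) / p)) * (8 * C) `^ (- s).
have c0 : 0 < c by rewrite mulr_gt0// powR_gt0// mulr_gt0.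
exists (Num.min c 2^-1); split; first by rewrite lt_min c0 /= invr_gt0.
move=> x y r r' sub r0 rr'.
have r'0 : 0 < r' by apply: lt_le_trans rr'.
have muB := mu_ball hX y r'0; case/andP: (muB) => B0 By.
have Bf := mu_ball_fin hX y r'0; have xf := mu_ball_fin hX x r0.
have /andP[x0 xy] := mu_ball hX x r0.
have rs0 : 0 <= (r / r') `^ s by exact: powR_ge0.
have B0' : 0 < fine (mu (ball y r')) by rewrite fine_gt0// B0.
have [big|small] := leP (2^-1 * fine (mu (ball y r'))) (fine (mu (ball x r))).
  rewrite mass_ratio_mu// lee_fin; apply: (@le_trans _ _ 2^-1).
    apply: (@le_trans _ _ (2^-1 * 1)); last by rewrite mulr1.
    apply: ler_pM; rewrite ?ge_min ?lexx ?orbT ?le_min ?(ltW c0) ?invr_ge0//=.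
    by rewrite powR_le1 ?(ltW s0)// divr_ge0 ?(ltW r0) ?(ltW r'0)//= ler_pdivrMr// mul1r.
  by rewrite ler_pdivlMr.
apply: (@le_trans _ _ (c * (r / r') `^ s)%:E).
  by rewrite lee_fin ler_wpM2r// ge_min lexx.
apply: lower_bound_of_recursion => //; first by rewrite mulr_gt0.
move=> j.
have sr'0 : 0 < sigma * r' by rewrite mulr_gt0.
have muW := mu_ball hX y sr'0; case/andP: (muW) => W0 Wy.
have mW : measurable (ball y (sigma * r')) := measurable_metric_ball _ _.
have mB : measurable (ball y r') := measurable_metric_ball _ _.
have rj0 : 0 < shrinking_radius r j by apply: lt_trans (shrinking_radius_gt j r0); rewrite divr_gt0.
have [u [g [mu_ u1 u0 uM um]]] := cutoff_M1p x rj0 (shrinking_radius_lt j r0).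
have [Mu Dg] := uM _ p mW hp.
have [_ pg] := um _ p mW muW hp.
set A1 := ball x (shrinking_radius r j.+1) in u1 *.
set A0 := ball x (shrinking_radius r j) in u0 um pg *.
have mA1 : measurable A1 := measurable_metric_ball _ _.
have mA0 : measurable A0 := measurable_metric_ball _ _.
have A0x : A0 `<=` ball x r.
  by apply: sub_ball; rewrite mdistxx add0r; exact: shrinking_radius_le.
have A1x : A1 `<=` ball x r.
  by apply: sub_ball; rewrite mdistxx add0r; exact: shrinking_radius_le.
have q0 : 0 < sobolev_exponent s p by rewrite divr_gt0 ?mulr_gt0 ?subr_gt0.
have BW : (mu (ball y r') <= mu (ball y (sigma * r')) < +oo)%E.
  rewrite Wy andbT; apply: le_measure; rewrite ?inE//.
  by apply: sub_ball; rewrite mdistxx add0r ler_peMl// ltW.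
have low A gamma : measurable A -> A `<=` ball y r' ->
    (forall z, A z -> 2^-1 <= `|u z - gamma|) ->
    ((2^-1 * mass_ratio mu A (ball y (sigma * r')) `^ (sobolev_exponent s p)^-1)%:E <=
      pmean mu (ball y r') (sobolev_exponent s p) (fun z => (u z - gamma)%R))%E.
  move=> mA AB; apply: pmean_ge_supp => //.
  by apply: measurable_funB => //; exact: measurable_funS mu_.
(* Both [A1] and [A0] lie in [ball x r], which has less than half of the mass, so the complement of
   [A0] outweighs [A1]. *)
have A1_le : mass_ratio mu A1 (ball y (sigma * r')) <=
    mass_ratio mu (ball y r' `\` A0) (ball y (sigma * r')).
  rewrite ler_wpM2r ?invr_ge0 ?fine_ge0//.
  have A1_x : fine (mu A1) <= fine (mu (ball x r)).
    have le : (mu A1 <= mu (ball x r))%E.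
      by apply: le_measure; rewrite ?inE//; exact: measurable_metric_ball.
    by rewrite fine_le// ge0_fin_numE//; exact: le_lt_trans xy.
  have A0_x : (mu A0 <= mu (ball x r))%E.
    by apply: le_measure; rewrite ?inE//; exact: measurable_metric_ball.
  have A0f : mu A0 \is a fin_num by rewrite ge0_fin_numE//; exact: le_lt_trans xy.
  have BA : (mu (ball y r' `\` A0) <= mu (ball y r'))%E.
    by apply: le_measure; rewrite ?inE//; exact: measurableD.
  have BAf : mu (ball y r' `\` A0) \is a fin_num by rewrite ge0_fin_numE//; exact: le_lt_trans By.
  have : mu (ball y r') = (mu (ball y r' `\` A0) + mu A0)%E.
    have BA0 : ball y r' `&` A0 = A0 by apply: setIidr; exact: subset_trans sub.
    by rewrite (measureDI mu mB mA0) BA0.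
  move: A0_x; rewrite -(fineK Bf) -(fineK BAf) -(fineK A0f) -(fineK xf) lee_fin.
  by move=> A0_x; rewrite -EFinD => -[]; lra.
have inf_low : ((2^-1 * mass_ratio mu A1 (ball y (sigma * r')) `^ (sobolev_exponent s p)^-1)%:E <=
    ereal_inf [set pmean mu (ball y r') (sobolev_exponent s p)
                      (fun z => (u z - gamma)%R) | gamma in [set: R]])%E.
  apply/ereal_infP => _ [gamma _ <-].
  have [g12|g12] := leP gamma 2^-1.
    apply: low => //; first exact: subset_trans sub.
    by move=> z /u1 ->; apply: le_trans (ler_norm _); lra.
  apply: (le_trans _ (low (ball y r' `\` A0) gamma _ _ _)).
  - rewrite lee_fin ler_pM2l ?invr_gt0//.
    apply: ge0_ler_powR; rewrite ?nnegrE ?invr_ge0 ?(ltW q0) ?divr_ge0 ?fine_ge0//.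
  - exact: measurableD.
  - by move=> z [].
  - by move=> z [_ /u0 ->]; rewrite distrC subr0; apply: le_trans (ler_norm _); lra.
have := le_trans inf_low (est y r' r'0 u g Mu Dg).
set m := mass_ratio mu A0 _ `^ _ in pg *.
have m0 : 0 <= m by exact: powR_ge0.
move=> h.
have {}h : ((2^-1 * mass_ratio mu A1 (ball y (sigma * r')) `^ (sobolev_exponent s p)^-1)%:E <=
    (C * r')%:E * (4 * 2 ^+ j / r * m)%:E)%E.
  apply: (le_trans h); rewrite -shrinking_radius_step//.
  by apply: lee_wpmul2l => //; rewrite lee_fin ltW// mulr_gt0.
move: h; rewrite -EFinM lee_fin ler_pdivrMl//.
have -> : 2 * (C * r' * (4 * 2 ^+ j / r * m)) = 8 * C * (r' / r) * 2 ^+ j * m by field; rewrite gt_eqF.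
by [].
Qed.

End LowerBoundFromSobolev.

(** * A single cutoff and uniform perfectness *)

Section LowerBoundFromHolder.
Context {R : realType} {d : measure_display} {X : borelMetricType R d}.
Variable mu : {measure set X -> \bar R}.
Hypothesis hX : metric_measure_space mu.
Hypothesis hup : uniformly_perfect X.
Implicit Types (x y z : X).
Variables (sigma s p C : R).
Hypotheses (hsigma : 1 < sigma) (hs : 0 < s) (hsp : s < p) (hC : 0 < C).
Hypothesis holder : holder_estimate mu sigma s p C.

Let sigma0 : 0 < sigma. Proof. by apply: lt_trans hsigma. Qed.
Let p0 : 0 < p. Proof. exact: lt_trans hsp. Qed.

(* [u] is a cutoff around [x] vanishing near [z]. As the estimate concerns only a
   representative [v], it is used at points [x'], [z'] close to [x], [z] where [v = u]. *)
Lemma holder_mass_ratio lambda x0 R0 x z r : 0 < lambda < 1 ->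
  0 < R0 -> (R0%:E <= diameter X)%E -> 0 < r -> ball x r `<=` ball x0 R0 ->
  ball x r z -> ~ ball x (lambda * r) z ->
  ((lambda / (C * 8)) `^ p) * (r / R0) `^ s <= mass_ratio mu (ball x r) (ball x0 (sigma * R0)).
Proof.
move=> /andP[l0 l1] R00 R0diam r0 sub xz nxz.
have lr0 : 0 < lambda * r by rewrite mulr_gt0.
have dxz : mdist x z < r by exact/in_ballP.
have lz : lambda * r <= mdist x z by rewrite leNgt; apply/negP => /in_ballP.
have rho0 : 0 < lambda * r / 2 by rewrite divr_gt0.
have rho : lambda * r / 4 < lambda * r / 2 by lra.
have [u [g [mu_ u1 u0 uM um]]] := cutoff_M1p hX x rho0 rho.
have [Mu Dg] := uM _ p measurableT p0.
have sR0 : 0 < sigma * R0 by rewrite mulr_gt0.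
have mW : measurable (ball x0 (sigma * R0)) := measurable_metric_ball _ _.
have [_ pg] := um _ p mW (mu_ball hX x0 sR0) p0.
have [v [vu vH]] := @holder u g Mu Dg x0 R0 R00 R0diam.
have lrr : lambda * r < r by rewrite gtr_pMl.
have rho1 : 0 < lambda * r / 4 by lra.
have [x' [/in_ballP xx' vx']] := ae_ball hX x vu rho1.
(* The first bound keeps [z'] in [ball x r], the second keeps it outside the support of [u]. *)
pose e := Num.min (r - mdist x z) (lambda * r / 2).
have e0 : 0 < e by rewrite lt_min rho0 subr_gt0 dxz.
have [z' [/in_ballP zz' vz']] := ae_ball hX z vu e0.
move: zz'; rewrite lt_min => /andP[zz'1 zz'2].
have txz' := metric_triangle x z z'.
have txz := metric_triangle x z' z; rewrite (metric_sym z' z) in txz.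
have Bx' : ball x0 R0 x' by apply: sub; apply/in_ballP; lra.
have Bz' : ball x0 R0 z' by apply: sub; apply/in_ballP; lra.
have ux' : u x' = 1 by apply: u1; apply/in_ballP.
have uz' : u z' = 0 by apply: u0 => /in_ballP; lra.
have dx'z' : mdist x' z' <= 2 * r.
  by have := metric_triangle x' x z'; rewrite (metric_sym x' x); lra.
have sp1 : 0 < 1 - s / p by rewrite subr_gt0 ltr_pdivrMr// mul1r.
have Rs0 : 0 < R0 `^ (s / p) by exact: powR_gt0.
have := vH _ _ Bx' Bz'; rewrite vx' vz' ux' uz' subr0 normr1.
set m := mass_ratio mu (ball x (lambda * r / 2)) _ in pg *.
have m0 : 0 <= m by rewrite divr_ge0 ?fine_ge0.
have c0 : 0 <= C * mdist x' z' `^ (1 - s / p) * R0 `^ (s / p).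
  by rewrite !mulr_ge0 ?powR_ge0// ltW.
move=> /le_trans => /(_ _ (lee_wpmul2l _ pg)); rewrite lee_fin => /(_ c0).
rewrite -EFinM lee_fin.
have -> : lambda * r / 2 - lambda * r / 4 = lambda * r / 4 by field.
move=> h.
have {}h : 1 <= C * (2 * (r / r `^ (s / p))) * R0 `^ (s / p) * ((lambda * r / 4)^-1 * m `^ p^-1).
  apply: (le_trans h); rewrite ler_wpM2r//.
    by rewrite mulr_ge0 ?powR_ge0// invr_ge0; lra.
  rewrite ler_pM2r// ler_pM2l//.
  apply: (@le_trans _ _ ((2 * r) `^ (1 - s / p))).
    by apply: ge0_ler_powR; rewrite ?nnegrE ?mdist_ge0 ?(ltW sp1)//; lra.
  have -> : r / r `^ (s / p) = r `^ (1 - s / p).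
    by rewrite powRB ?powRr1 ?(ltW r0)//; apply/implyP => _; rewrite gt_eqF.
  rewrite powRM ?(ltW r0)// ler_pM2r ?powR_gt0//.
  rewrite -[leRHS](@powRr1 R 2)//; apply: ler_powR; first lra.
  by rewrite gerBl divr_ge0 ?ltW.
have rs0 : 0 < r `^ (s / p) by exact: powR_gt0.
(* [8 = 2 * 4]: the distance of [x'] and [z'] is at most [2 * r], with [2 ^ (1 - s / p) <= 2], and
   the cutoff has slope [4 / (lambda * r)]. *)
have {}h : lambda / (C * 8) * (r / R0) `^ (s / p) <= m `^ p^-1.
  rewrite powR_div ?(ltW r0) ?(ltW R00)//.
  set M := m `^ p^-1 in h *.
  have -> : M = lambda / (C * 8) * (r `^ (s / p) / R0 `^ (s / p)) *
     (C * (2 * (r / r `^ (s / p))) * R0 `^ (s / p) * ((lambda * r / 4)^-1 * M)).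
    by field; rewrite !gt_eqF.
  by rewrite ler_peMr// !mulr_ge0 ?divr_ge0 ?invr_ge0// ?mulr_ge0 ?ltW.
have mE : m = (m `^ p^-1) `^ p by rewrite -powRrM mulVf ?gt_eqF// powRr1.
have mm : m <= mass_ratio mu (ball x r) (ball x0 (sigma * R0)).
  apply: mass_ratio_le; try exact: measurable_metric_ball.
    by apply: sub_ball; rewrite mdistxx add0r; lra.
  by case/andP: (mu_ball hX x r0).
apply: le_trans mm; rewrite mE.
have -> : (lambda / (C * 8)) `^ p * (r / R0) `^ s = (lambda / (C * 8) * (r / R0) `^ (s / p)) `^ p.
  rewrite [RHS](@powRM _ (lambda / (C * 8))) ?powR_ge0 ?divr_ge0 ?mulr_ge0 ?(ltW l0) ?(ltW hC)// -powRrM.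
  by congr (_ * _ `^ _); field; rewrite gt_eqF.
apply: ge0_ler_powR; rewrite ?nnegrE ?powR_ge0 ?(ltW p0)//.
by rewrite mulr_ge0 ?powR_ge0 ?divr_ge0 ?mulr_ge0 ?(ltW l0) ?(ltW hC).
Qed.

(** If [ball x r] is all of [X], both balls coincide. Otherwise uniform perfectness provides [z].
    The estimate is available only for radii up to the diameter, so a larger [r'] is replaced by the
    diameter, with center [x]. *)
Lemma lower_bound_of_holder : exists kappa, 0 < kappa /\ measure_lower_bound mu s kappa.
Proof.
have [lambda [l01 perfect]] := hup.
have [l0 l1] := andP l01.
pose c := (lambda / (C * 8)) `^ p.
have c0 : 0 < c by rewrite powR_gt0// divr_gt0// mulr_gt0.
exists (Num.min c 1); split; first by rewrite lt_min c0 ltr01.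
move=> x y r r' sub r0 rr'.
have r'0 : 0 < r' by apply: lt_le_trans rr'.
have muB := mu_ball hX y r'0; case/andP: (muB) => B0 By.
have /andP[x0 xy] := mu_ball hX x r0.
have rr1 : r / r' <= 1 by rewrite ler_pdivrMr// mul1r.
have rr0 : 0 <= r / r' by rewrite divr_ge0 ?ltW.
rewrite mass_ratio_mu// lee_fin.
have [[w [_ nxw]]|/set0P/negP/negPn/eqP full] := pselect ([set: X] `\` ball x r !=set0); last first.
  have -> : ball y r' = ball x r.
    apply/seteqP; split=> // z _; apply: contrapT => xz.
    by have : ([set: X] `\` ball x r) z by []; rewrite full.
  rewrite /mass_ratio mulfV; last by rewrite gt_eqF// fine_gt0// x0.
  apply: (@le_trans _ _ (1 * 1)); last by rewrite mulr1.
  apply: ler_pM; rewrite ?powR_ge0 ?le_min ?(ltW c0) ?ge_min ?lexx ?orbT//=.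
  by rewrite powR_le1 ?rr0 ?(ltW hs).
have [z [xz nxz]] : ball x r `\` ball x (lambda * r) !=set0 by apply: perfect => //; exists w.
(* Passing from [R1] to [r'] and from the dilated ball to [ball y r'] both weaken the inequality in
   the required direction. *)
have concl x1 R1 : 0 < R1 -> R1 <= r' -> (R1%:E <= diameter X)%E ->
    ball x r `<=` ball x1 R1 -> ball y r' `<=` ball x1 (sigma * R1) ->
    Num.min c 1 * (r / r') `^ s <= mass_ratio mu (ball x r) (ball y r').
  move=> R10 R1r' R1d sub1 sub2.
  have sR1 : 0 < sigma * R1 by rewrite mulr_gt0.
  have /andP[W0 Wy] := mu_ball hX x1 sR1.
  apply: (@le_trans _ _ (c * (r / R1) `^ s)).
    apply: ler_pM; rewrite ?powR_ge0 ?le_min ?(ltW c0) ?ge_min ?lexx ?orbT//=.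
    apply: ge0_ler_powR; rewrite ?nnegrE ?divr_ge0 ?(ltW hs) ?(ltW r0) ?(ltW R10) ?(ltW r'0)//.
    by rewrite ler_pM2l// lef_pV2 ?posrE.
  apply: (le_trans (holder_mass_ratio l01 R10 R1d r0 sub1 xz nxz)).
  rewrite ler_wpM2l ?fine_ge0// lef_pV2 ?posrE ?fine_gt0 ?W0 ?B0//.
  by rewrite fine_le ?ge0_fin_numE//; apply: le_measure; rewrite ?inE//; exact: measurable_metric_ball.
have [big|small] := leP r'%:E (diameter X).
  apply: (concl y r') => //; apply: sub_ball.
  by rewrite mdistxx add0r ler_peMl// ltW.
have le_diam (a b : X) : ((mdist a b)%:E <= diameter X)%E by apply: ereal_sup_ubound; exists a, b.
have rw : r <= mdist x w by rewrite leNgt; apply/negP => /in_ballP.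
have diamf : diameter X \is a fin_num.
  rewrite fin_numE; apply/andP; split.
    by rewrite gt_eqF//; apply: lt_le_trans (le_diam x x); exact: ltNyr.
  by rewrite lt_eqF//; apply: lt_trans small _; exact: ltry.
move: small le_diam; rewrite -(fineK diamf) lte_fin => small le_diam.
have rD : r <= fine (diameter X) by apply: (le_trans rw); rewrite -lee_fin.
have D0 : 0 < fine (diameter X) by exact: lt_le_trans rD.
apply: (concl x (fine (diameter X))) => //.
- exact: ltW.
- by rewrite fineK.
- by apply: sub_ball; rewrite mdistxx add0r.
(* The strict inequality [1 < sigma] captures points at distance exactly the diameter from [x]. *)
- move=> a _; apply/in_ballP.
  apply: (@le_lt_trans _ _ (fine (diameter X))); first by rewrite -lee_fin.
  by rewrite ltr_pMl.
Qed.

End LowerBoundFromHolder.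

(** * The equivalence *)

Theorem theorem4 (R : realType) (d : measure_display)
  (X : borelMetricType R d) (mu : {measure set X -> \bar R})
  (sigma s : R)
  (hX : metric_measure_space mu) (hup : uniformly_perfect X)
  (hsigma : 1 < sigma) (hs : 0 < s) :
  [<-> (exists kappa : R, 0 < kappa /\ measure_lower_bound mu s kappa);
       (exists p C : R, [/\ 0 < p < s, 0 < C & sobolev_estimate mu sigma s p C]);
       (exists p C : R,
          [/\ 0 < p < s, 0 < C & sobolev_poincare_estimate mu sigma s p C]);
       (exists p C : R, [/\ s < p, 0 < C & holder_estimate mu sigma s p C])]
  /\
  (forall p C : R, s < p -> 0 < C -> holder_estimate mu sigma s p C ->
     holder_representatives mu sigma s p).
Proof.
split.
  tfae.
  - by move=> [kappa [k0 lower]]; exact: (sobolev_of_lower_bound hX hsigma hs k0 lower).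
  - move=> [p [C [/andP[p0 ps] C0 /(lower_bound_of_sobolev hX hsigma p0 ps C0)]]].
    by move=> [kappa [k0 lower]]; exact: (sobolev_poincare_of_lower_bound hX hsigma hs k0 lower).
  - move=> [p [C [/andP[p0 ps] C0 /(lower_bound_of_sobolev_poincare hX hsigma p0 ps C0)]]].
    move=> [kappa [k0 lower]].
    (* Any exponent above [s] would do. *)
    have sp : s < 2 * s by lra.
    have [C' C'0 rep] := holder_representative hX hsigma hs k0 sp lower.
    exists (2 * s), C'; split=> // u g _ Dg x0 R0 R00 _.
    apply: rep => //; apply: hajlasz_gradientS Dg => //; exact: measurable_metric_ball.
  - move=> [p [C [sp C0 /(lower_bound_of_holder hX hup hsigma hs sp C0)]]].
    by move=> [kappa [k0 lower]]; exists kappa.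
(* The Hoelder estimate concerns functions on all of [X], whereas [u] is given on one ball only. The
   lower bound bridges this: it returns the estimate for the same [p] from a gradient on that ball
   alone. *)
move=> p C sp C0 /(lower_bound_of_holder hX hup hsigma hs sp C0) [kappa [k0 lower]].
have p0 : 0 < p by apply: lt_trans sp.
have [C' C'0 rep] := holder_representative hX hsigma hs k0 sp lower.
move=> x0 R0 R00 _ u [_ [g Dg]].
have sR0 : 0 < sigma * R0 by rewrite mulr_gt0//; lra.
have [v [vu vH]] := rep _ _ _ _ R00 Dg.
have Lg : Lp_on mu (ball x0 (sigma * R0)) p g by case: Dg.
have [G0 G00 gE] := pmean_Lp p0 (mu_ball hX x0 sR0) Lg.
exists v; split.
  by apply: filterS vu => x ->.
exists (C' * R0 `^ (s / p) * G0) => x y Bx By.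
have := vH _ _ Bx By; rewrite gE -EFinM lee_fin => /le_trans; apply.
by rewrite le_eqVlt; apply/orP; left; apply/eqP; ring.
Qed.
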